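(* Let $a<b$, $0<\alpha,\beta<1$, and $y_a,y_b,l\in\mathbb R$. Let $L,g:[a,b]\times\mathbb R^3\to\mathbb R$ be of class $C^1$ and, for $y\in{}_a^{\alpha}E_b^{\beta}$, put $$J(y)=\int_a^b L[y](x)\,dx,\qquad I(y)=\int_a^b g[y](x)\,dx,\qquad [y](x)=\big(x,y(x),{}_a^CD_x^\alpha y(x),{}_x^CD_b^\beta y(x)\big).$$ Assume that $\partial_3L$ and $\partial_3g$ have continuous right Riemann--Liouville derivatives of order $\alpha$ and that $\partial_4L$ and $\partial_4g$ have continuous left Riemann--Liouville derivatives of order $\beta$ on $[a,b]$. Let $y\in{}_a^{\alpha}E_b^{\beta}$ be a local minimum of $J$ subject to the conditions $$y(a)=y_a,\qquad y(b)=y_b,\qquad I(y)=l.$$ Then there exist two constants $\lambda_0,\lambda\in\mathbb R$, with $(\lambda_0,\lambda)\neq(0,0)$, such that, with $K=\lambda_0L+\lambda g$, $$\partial_2 K[y](x)+{}_xD_b^\alpha\, \partial_3 K[y](x)+{}_aD_x^\beta\,\partial_4 K[y](x)=0\qquad\text{for all }x\in[a,b].$$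
   Context: Fractional operators. Let $0<\gamma<1$ and let $\Gamma$ be the Euler gamma function. The left and right Riemann--Liouville derivatives of order $\gamma$ are $${}_aD_x^\gamma f(x)=\frac{1}{\Gamma(1-\gamma)}\frac{d}{dx}\int_a^x (x-t)^{-\gamma}f(t)\,dt,\qquad {}_xD_b^\gamma f(x)=\frac{-1}{\Gamma(1-\gamma)}\frac{d}{dx}\int_x^b (t-x)^{-\gamma}f(t)\,dt$$ (one-sided derivatives at endpoints). The left and right Caputo derivatives are, for absolutely continuous $f:[a,b]\to\mathbb R$, $${}_a^CD_x^\gamma f(x)=\frac{1}{\Gamma(1-\gamma)}\int_a^x (x-t)^{-\gamma}f'(t)\,dt,\qquad {}_x^CD_b^\gamma f(x)=\frac{-1}{\Gamma(1-\gamma)}\int_x^b (t-x)^{-\gamma}f'(t)\,dt,$$ with the value at $x=a$ (left) or $x=b$ (right) understood as the limit. Function space: ${}_a^{\alpha}E_b^{\beta}$ is the set of $y:[a,b]\to\mathbb R$ for which ${}_a^CD_x^\alpha y$ and ${}_x^CD_b^\beta y$ exist and are continuous on $[a,b]$. $\partial_i$ denotes the partial derivative with respect to the $i$-th variable, $i=1,2,3,4$, of a function of $(x,y,u,v)$. Fractional derivatives of $\partial_3L$, $\partial_4L$, $\partial_3 g$, $\partial_4 g$ are taken of the functions $x\mapsto\partial_iL[y](x)$, $x\mapsto\partial_ig[y](x)$. A function $y\in{}_a^{\alpha}E_b^{\beta}$ satisfying $y(a)=y_a$, $y(b)=y_b$, $I(y)=l$ is called admissible. Fix a norm $\|\cdot\|$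 on ${}_a^{\alpha}E_b^{\beta}$ (any norm). $y$ is a local minimum of $J$ subject to the conditions if it is admissible and there is $\delta>0$ with $J(y)\le J(y_1)$ for every admissible $y_1$ with $\|y-y_1\|<\delta$. *)

(* Defs.v *)
From HB Require Import structures.
From mathcomp Require Import all_boot all_order all_algebra.
From mathcomp Require Import all_classical all_reals all_analysis.
Set Implicit Arguments.
Unset Strict Implicit.
Unset Printing Implicit Defensive.
Import Order.TTheory GRing.Theory Num.Theory.
Import numFieldNormedType.Exports.
Local Open Scope classical_set_scope.
Local Open Scope ring_scope.

(* A function on [a, b] is represented by a total function R -> R, of which
   only the values on [a, b] are relevant. *)
Section FractionalOperators.
Context {R : realType}.
Local Notation mu := (@lebesgue_measure R).
Implicit Types (a b c x gam : R) (f : R -> R).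

Definition Gamma (z : R) : R :=
  \int[mu]_(t in `]0, +oo[) (t `^ (z - 1) * expR (- t)).

Definition abs_continuous a b f : Prop :=
  forall e : R, 0 < e -> exists2 d : R, 0 < d &
  forall (n : nat) (u v : 'I_n -> R),
    (forall i, a <= u i /\ u i <= v i /\ v i <= b) ->
    trivIset [set: 'I_n] (fun i => `]u i, v i[%classic) ->
    \sum_(i < n) (v i - u i) < d ->
    \sum_(i < n) `|f (v i) - f (u i)| < e.

(* The difference quotient is restricted to [a, b]: the derivative is the
   ordinary one at interior points and one-sided at a and at b. *)
Definition diff_quot_on a b f x : set_system R :=
  (f z - f x) / (z - x) @[z --> within `[a, b] x^'].

Definition derivable_on a b f x : Prop := cvg (diff_quot_on a b f x).

Definition derive_on a b f x : R := lim (diff_quot_on a b f x).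

Definition abel_left gam a f x : R :=
  \int[mu]_(t in `[a, x]) ((x - t) `^ (- gam) * f t).

Definition abel_right gam b f x : R :=
  \int[mu]_(t in `[x, b]) ((t - x) `^ (- gam) * f t).

Definition abel_left_exists gam a f x : Prop :=
  mu.-integrable `[a, x] (fun t => ((x - t) `^ (- gam) * f t)%:E).

Definition abel_right_exists gam b f x : Prop :=
  mu.-integrable `[x, b] (fun t => ((t - x) `^ (- gam) * f t)%:E).

Definition RL_left gam a b f x : R :=
  (Gamma (1 - gam))^-1 * derive_on a b (abel_left gam a f) x.

Definition RL_right gam a b f x : R :=
  - (Gamma (1 - gam))^-1 * derive_on a b (abel_right gam b f) x.

Definition has_continuous_RL_left gam a b f : Prop :=
  [/\ forall x, x \in `[a, b] -> abel_left_exists gam a f x,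
      forall x, x \in `[a, b] -> derivable_on a b (abel_left gam a f) x
    & {within `[a, b], continuous (RL_left gam a b f)}].

Definition has_continuous_RL_right gam a b f : Prop :=
  [/\ forall x, x \in `[a, b] -> abel_right_exists gam b f x,
      forall x, x \in `[a, b] -> derivable_on a b (abel_right gam b f) x
    & {within `[a, b], continuous (RL_right gam a b f)}].

(* An absolutely continuous f is differentiable almost everywhere on [a, b],
   so the values of derive1 f where f is not differentiable do not affect the
   integrals below. *)
Definition caputo_left_int gam a f x : R :=
  (Gamma (1 - gam))^-1 * abel_left gam a (derive1 f) x.

Definition caputo_right_int gam b f x : R :=
  - (Gamma (1 - gam))^-1 * abel_right gam b (derive1 f) x.

Definition caputo_left gam a f x : R :=
  if x == a then lim (caputo_left_int gam a f z @[z --> a^'+])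
  else caputo_left_int gam a f x.

Definition caputo_right gam b f x : R :=
  if x == b then lim (caputo_right_int gam b f z @[z --> b^'-])
  else caputo_right_int gam b f x.

Definition has_continuous_caputo_left gam a b f : Prop :=
  [/\ forall x, x \in `]a, b] -> abel_left_exists gam a (derive1 f) x,
      cvg (caputo_left_int gam a f z @[z --> a^'+])
    & {within `[a, b], continuous (caputo_left gam a f)}].

Definition has_continuous_caputo_right gam a b f : Prop :=
  [/\ forall x, x \in `[a, b[ -> abel_right_exists gam b (derive1 f) x,
      cvg (caputo_right_int gam b f z @[z --> b^'-])
    & {within `[a, b], continuous (caputo_right gam b f)}].

Definition caputo_space alpha beta a b : set (R -> R) :=
  [set y | [/\ abs_continuous a b y,
               has_continuous_caputo_left alpha a b y
             & has_continuous_caputo_right beta a b y]].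

(* Clause 2 also makes N f depend only on the values of f on [a, b]: if f = g
   on [a, b], then N (f - g) = 0 and hence N f = N g. *)
Definition norm_on_interval a b (E : set (R -> R)) (N : (R -> R) -> R) : Prop :=
  [/\ forall f, E f -> 0 <= N f,
      forall f, E f -> (N f = 0 <-> forall x, x \in `[a, b] -> f x = 0),
      forall (k : R) f, E f -> N (k *: f) = `|k| * N f
    & forall f g, E f -> E g -> N (f + g) <= N f + N g].

End FractionalOperators.

Section Lagrangians.
Context {R : realType}.
Local Notation mu := (@lebesgue_measure R).
Implicit Types (a b alpha beta : R) (y : R -> R) (F : R -> R -> R -> R -> R).

(* F (x, y, u, v) matters only for x in [a, b]; the partial derivative in x is
   therefore one-sided at x = a and x = b. *)
Definition partial1 a b F : R -> R -> R -> R -> R :=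
  fun x (y : R) u v => derive_on a b (fun z => F z y u v) x.
Definition partial2 F : R -> R -> R -> R -> R :=
  fun x (y : R) u v => derive1 (fun z => F x z u v) y.
Definition partial3 F : R -> R -> R -> R -> R :=
  fun x (y : R) u v => derive1 (fun z => F x y z v) u.
Definition partial4 F : R -> R -> R -> R -> R :=
  fun x (y : R) u v => derive1 (fun z => F x y u z) v.

Definition continuous_on_slab a b F : Prop :=
  {within [set p : R * R * R * R | p.1.1.1 \in `[a, b]],
    continuous (fun p : R * R * R * R => F p.1.1.1 p.1.1.2 p.1.2 p.2)}.

Definition class_C1 a b F : Prop :=
  (forall (x y u v : R), x \in `[a, b] ->
    [/\ derivable_on a b (fun z => F z y u v) x,
        derivable (fun z => F x z u v) y 1,
        derivable (fun z => F x y z v) u 1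
      & derivable (fun z => F x y u z) v 1]) /\
  [/\ continuous_on_slab a b (partial1 a b F),
      continuous_on_slab a b (partial2 F),
      continuous_on_slab a b (partial3 F)
    & continuous_on_slab a b (partial4 F)].

(* x |-> F[y](x) *)
Definition along alpha beta a b F y (x : R) : R :=
  F x (y x) (caputo_left alpha a y x) (caputo_right beta b y x).

Definition functional alpha beta a b F y : R :=
  \int[mu]_(x in `[a, b]) along alpha beta a b F y x.

Definition admissible alpha beta a b ya yb l g y : Prop :=
  [/\ caputo_space alpha beta a b y, y a = ya, y b = yb
    & functional alpha beta a b g y = l].

Definition local_minimum alpha beta a b ya yb l L g
    (N : (R -> R) -> R) y : Prop :=
  admissible alpha beta a b ya yb l g y /\
  exists2 d : R, 0 < d &
  forall y1, admissible alpha beta a b ya yb l g y1 -> N (y - y1) < d ->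
    functional alpha beta a b L y <= functional alpha beta a b L y1.

End Lagrangians.

(* Main.v *)
(* The set of y1 = y + s h + t k, with h and k of class C^1 on R and zero outside ]a, b[,
   is a two-parameter family in the function space with the boundary values of y. Along it
   J and I are differentiable at y, with first variations D_L and D_g that are linear in
   the test function. If D_L(h) D_g(k) <> D_L(k) D_g(h) for some h and k, then a
   combination of h and k leaves I stationary and decreases J, and the intermediate value
   theorem in the remaining direction restores I = l, contradicting minimality. So a
   nontrivial combination of D_L and D_g vanishes on all test functions. Fubini for the
   weakly singular kernel and an ordinary integration by parts turn D_F(k) into the
   integral of k times the Euler-Lagrange expression of F, and bump functions show that
   the combined expression vanishes identically.

   That y + k remains in the function space needs (y + k)' = y' + k' almost everywhere,
   hence the almost everywhere differentiability of absolutely continuous functions: at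
   the other points [derive1] is a junk value. The total variation reduces it to the
   monotone case, which follows from the Radon-Nikodym theorem. *)
Require Import Defs.
From HB Require Import structures.
From mathcomp Require Import all_boot all_order all_algebra.
From mathcomp Require Import all_classical all_reals all_analysis.
From mathcomp Require Import measurable_realfun ring lra.
Set Implicit Arguments.
Unset Strict Implicit.
Unset Printing Implicit Defensive.
Import Order.TTheory GRing.Theory Num.Theory.
Import numFieldNormedType.Exports.
Local Open Scope classical_set_scope.
Local Open Scope ring_scope.

(** The norm [N] is arbitrary, so a competitor is shown to be close to [y] only by homogeneity and
    the triangle inequality over fixed directions; hence the restriction to combinations of two test
    functions. The intermediate value theorem asks only for a first-order expansion of the
    functionals at [y] and for continuity of [I] along lines.

    Test functions are [C^1] on the whole line because their derivative is then continuous and zero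
    off [[a, b]]. A substitution in the Abel integral therefore makes their Caputo derivatives
    continuous up to both ends, and the boundary terms of the integration by parts vanish.

    Left and right operators are mirror images, and a sign [e] carries both. Exchanging the
    variables of the kernel turns [e] into [- e], which is why a left Caputo derivative is paired
    with a right Riemann-Liouville one.

    Lebesgue measure lives here on the Borel sets, so equality almost everywhere does not transfer
    measurability. The derivative of [y + k] must therefore be shown to be measurable, besides being
    equal almost everywhere to [y' + k']. *)

(** * Absolute continuity tested on finite lists of intervals *)

Section AbsoluteContinuity.
Context {R : realType}.
Local Notation TV := total_variation.
Implicit Types (a b : R) (f : R -> R) (s : seq (R * R)).

Definition nonoverlapping (p q : R * R) := (p.2 <= q.1) || (q.2 <= p.1).
Definition subinterval a b (p : R * R) := [&& a <= p.1, p.1 <= p.2 & p.2 <= b].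
Definition total_length s : R := \sum_(p <- s) (p.2 - p.1).
Definition total_increment f s : R := \sum_(p <- s) `|f p.2 - f p.1|.

(** Lists can be concatenated and treated by induction, and the bound [<= e], unlike a strict one,
    survives the passage from partitions to the total variation, which is a supremum. *)
Definition seq_ac a b f := forall e, 0 < e -> exists2 d, 0 < d &
  forall s, all (subinterval a b) s -> pairwise nonoverlapping s ->
    total_length s < d -> total_increment f s <= e.

Lemma nonoverlapping_sym : symmetric nonoverlapping.
Proof. by move=> p q; rewrite /nonoverlapping orbC. Qed.

Lemma abs_continuous_seq_ac a b f : abs_continuous a b f -> seq_ac a b f.
Proof.
move=> acf e e0; have [d d0 H] := acf e e0; exists d => // s sab sep len.
have := H (size s) (fun i => (nth (0, 0) s i).1) (fun i => (nth (0, 0) s i).2).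
rewrite /total_increment (big_nth (0, 0)) big_mkord => h; apply/ltW/h.
- move=> i; have /allP/(_ (nth (0, 0) s i)) := sab.
  by rewrite mem_nth// => /(_ isT)/and3P[].
- move=> i j _ _ [x [/=]]; rewrite !in_itv/= => /andP[i1 i2] /andP[j1 j2].
  apply/eqP/negPn/negP => ij.
  have /(pairwiseP (0, 0)) P := sep.
  have [lij|lij|/val_inj/eqP] := ltngtP i j; last by rewrite (negbTE ij).
  + have := P i j (ltn_ord i) (ltn_ord j) lij; rewrite /nonoverlapping => /orP[|]; lra.
  + have := P j i (ltn_ord j) (ltn_ord i) lij; rewrite /nonoverlapping => /orP[|]; lra.
- by move: len; rewrite /total_length (big_nth (0, 0)) big_mkord.
Qed.

Fixpoint consecutive a (t : seq R) : seq (R * R) :=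
  if t is x :: t' then (a, x) :: consecutive x t' else [::].

Lemma consecutive_sub a b t : itv_partition a b t ->
  all (subinterval a b) (consecutive a t).
Proof.
elim: t a => // x t ih a [/= /andP[ax xt] lt].
have xb : x <= b by apply: (itv_partition_le (s := t)); split.
rewrite /subinterval/= lexx (ltW ax) xb/=.
have pt : itv_partition x b t by split.
have := ih x pt; apply: sub_all => p; rewrite /subinterval => /and3P[]; lra.
Qed.

Lemma consecutive_pairwise a b t : itv_partition a b t ->
  pairwise nonoverlapping (consecutive a t).
Proof.
elim: t a => // x t ih a [/= /andP[ax xt] lt].
have pt : itv_partition x b t by split.
rewrite (ih x pt) andbT; have := consecutive_sub pt; apply: sub_all => p.
by rewrite /subinterval /nonoverlapping/= => /andP[->].
Qed.

Lemma consecutive_length a b t : itv_partition a b t ->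
  total_length (consecutive a t) = b - a.
Proof.
rewrite /total_length.
elim: t a => [a [_ /= /eqP ->]|x t ih a [/= /andP[ax xt] lt]].
  by rewrite big_nil subrr.
have pt : itv_partition x b t by split.
by rewrite big_cons (ih x pt)/= addrC addrA subrK.
Qed.

Lemma consecutive_increment a b f t : itv_partition a b t ->
  total_increment f (consecutive a t) = variation a b f t.
Proof.
rewrite /total_increment.
elim: t a => [a [_ /= /eqP ->]|x t ih a [/= /andP[ax xt] lt]].
  by rewrite big_nil /variation/= big_nil.
have pt : itv_partition x b t by split.
by rewrite big_cons (ih x pt)/= /variation/= [RHS]big_nat_recl//=.
Qed.

(* The intervals of [l1] are traded one at a time for the intervals of an arbitrary
   partition, whose increments then join [l2]. *)
Lemma sum_total_variation_le a b f (e d : R) (l1 l2 : seq (R * R)) :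
  (forall s, all (subinterval a b) s -> pairwise nonoverlapping s ->
    total_length s < d -> total_increment f s <= e) ->
  all (subinterval a b) (l1 ++ l2) -> pairwise nonoverlapping (l1 ++ l2) ->
  total_length (l1 ++ l2) < d ->
  (\sum_(p <- l1) TV p.1 p.2 f + (total_increment f l2)%:E <= e%:E)%E.
Proof.
move=> H; elim: l1 l2 => [l2|p l1 ih l2].
  by rewrite big_nil add0e lee_fin; exact: H.
rewrite /= => /andP[pab lab]; rewrite all_cat pairwise_cat => /andP[/andP[pl1 pl2]].
move=> /and3P[l12 pw1 pw2]; rewrite /total_length => len.
have ple : p.1 <= p.2 by move: pab => /and3P[].
have TVge0 (q : R * R) : q \in l1 -> (0 <= TV q.1 q.2 f)%E.
  move=> ql; apply: total_variation_ge0.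
  by move: lab; rewrite all_cat => /andP[/allP/(_ _ ql)/and3P[]].
(* The partition intervals of [p] move into the second list. They fill [p], so the total length is
   unchanged, and whatever does not overlap [p] does not overlap them. *)
have step t : itv_partition p.1 p.2 t ->
    (\sum_(q <- l1) TV q.1 q.2 f +
      (variation p.1 p.2 f t + total_increment f l2)%:E <= e%:E)%E.
  move=> pt; rewrite -(consecutive_increment f pt) /total_increment -big_cat.
  apply: ih.
  - move: lab; rewrite !all_cat => /andP[-> ->]; rewrite andbT/=.
    have := consecutive_sub pt; apply: sub_all => q.
    by move: pab; rewrite /subinterval => /and3P[? ? ?] /and3P[]; lra.
  - rewrite pairwise_cat pw1 allrel_catr l12 pairwise_cat pw2 !andbT/=.
    have psep (q : R * R) l : all (nonoverlapping p) l -> q \in consecutive p.1 t ->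
        all (nonoverlapping q) l.
      move=> pl /(allP (consecutive_sub pt)) /and3P[q1 q2 q3].
      by apply: sub_all pl => r; rewrite /nonoverlapping => /orP[h|h]; apply/orP;
        [left; exact: le_trans h|right; exact: le_trans h _].
    apply/andP; split; last first.
      rewrite (consecutive_pairwise pt) andbT.
      by apply/allrelP => q r ql rl; have /allP/(_ _ rl) := psep q l2 pl2 ql.
    apply/allrelP => q r ql rl; rewrite nonoverlapping_sym.
    by have /allP/(_ _ ql) := psep r l1 pl1 rl.
  - rewrite /total_length catA big_cat/=.
    have := consecutive_length pt; rewrite /total_length.
    by move: len; rewrite big_cons !big_cat/= => + ->; lra.
(* Moving this sum across an inequality in the extended reals requires it to be finite; the
   induction hypothesis with [p] left out shows that. *)
have cfin : (\sum_(q <- l1) TV q.1 q.2 f)%E \is a fin_num.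
  rewrite ge0_fin_numE; last by rewrite big_seq; exact: sume_ge0.
  have : (\sum_(q <- l1) TV q.1 q.2 f + (total_increment f l2)%:E <= e%:E)%E.
    apply: ih => //; first by rewrite pairwise_cat l12 pw1.
    by move: len; rewrite /total_length big_cons; lra.
  rewrite -leeBrDr// => /le_lt_trans; apply; exact: ltry.
rewrite big_cons -addeA -leeBrDr; last by rewrite fin_numD cfin.
apply: ge_ereal_sup => _ [_ [t pt <-] <-].
rewrite leeBrDr ?fin_numD ?cfin//.
by apply: le_trans (step t pt); rewrite EFinD addeCA.
Qed.

End AbsoluteContinuity.

(** * Total variation, constant extension, and measures of unions of intervals *)

Section AEDerivability.
Context {R : realType}.
Local Notation mu := (@lebesgue_measure R).
Local Notation TV := total_variation.
Implicit Types (a b : R) (f : R -> R) (s : seq (R * R)).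

(** On a piece shorter than the [d] that belongs to [e = 1] the variation is at most 1, and [n.+1]
    such pieces make up [[a, b]]. *)
Lemma seq_ac_total_variation_fin a b f : a <= b -> seq_ac a b f ->
  TV a b f \is a fin_num.
Proof.
move=> ab acf; have [d d0 H] := acf 1 ltr01.
pose n := (Num.truncn ((b - a) / d)).
have nd : (b - a) / d < n.+1%:R by apply: truncnS_gt.
pose h := (b - a) / n.+1%:R.
have h0 : 0 <= h by rewrite divr_ge0// subr_ge0.
have hd : h < d by rewrite /h ltr_pdivrMr// mulrC -ltr_pdivrMr.
have hn : n.+1%:R * h = b - a by rewrite /h mulrC divfK.
suff : forall k, (k <= n.+1)%N -> (TV a (a + k%:R * h) f <= k%:R%:E)%E.
  move=> /(_ n.+1 (leqnn _)); rewrite hn addrC subrK => TVle.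
  by rewrite ge0_fin_numE ?total_variation_ge0//; apply: le_lt_trans TVle (ltry _).
elim=> [_|k ih kn]; first by rewrite mul0r addr0 total_variationxx.
have kh : 0 <= k%:R * h by rewrite mulr_ge0.
have kS : k.+1%:R * h = k%:R * h + h by rewrite -natr1 mulrDl mul1r.
rewrite (@total_variationD _ a _ (a + k%:R * h)); [|lra|lra].
rewrite -[X in (_ <= X%:E)%E]natr1 EFinD leeD ?ih 1?ltnW//.
pose p := (a + k%:R * h, a + k.+1%:R * h).
have kb : k.+1%:R * h <= b - a by rewrite -hn ler_wpM2r// ler_nat.
have /= := @sum_total_variation_le _ a b f 1 d [:: p] [::] H.
rewrite /subinterval /total_length /total_increment !big_seq1 big_nil adde0/= andbT.
by apply => //; lra.
Qed.

(** The increment of [x |-> TV a x f] over an interval is the total variation on it, so the bound on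
    sums of variations applies with an empty second list. *)
Lemma seq_ac_total_variation a b f : seq_ac a b f ->
  seq_ac a b (fun x => fine (TV a x f)).
Proof.
move=> acf e e0; have [d d0 H] := acf e e0; exists d => // s sab sep len.
rewrite -lee_fin; have := @sum_total_variation_le _ a b f e d s [::] H.
rewrite cats0 => /(_ sab sep len); rewrite {1}/total_increment big_nil adde0.
apply: le_trans; rewrite /total_increment -sumEFin.
rewrite big_seq [leRHS]big_seq; apply: lee_sum => p /(allP sab)/and3P[ap pp pb].
have fin (x y : R) : a <= x -> x <= y -> y <= b -> TV x y f \is a fin_num.
  move=> ax xy yb; apply: seq_ac_total_variation_fin => // e' /acf[d' d'0 H'].
  exists d' => // s' s'xy; apply: H'; apply: sub_all s'xy => q /and3P[q1 q2 q3].
  by apply/and3P; split => //; lra.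
rewrite (@total_variationD _ a p.2 p.1)// fineD ?fin//; last lra.
rewrite addrAC subrr add0r ger0_norm ?fineK ?fin//.
by rewrite fine_ge0// total_variation_ge0.
Qed.

Lemma seq_acB a b f g : seq_ac a b f -> seq_ac a b g -> seq_ac a b (f \- g).
Proof.
move=> acf acg e e0; have e20 : 0 < e / 2 by rewrite divr_gt0.
have [d1 d10 H1] := acf _ e20.
have [d2 d20 H2] := acg _ e20.
exists (Num.min d1 d2) => [|s sab sep]; first by rewrite lt_min d10.
rewrite lt_min => /andP[len1 len2].
apply: (@le_trans _ _ (total_increment f s + total_increment g s)); last first.
  by rewrite (splitr e) lerD ?H1 ?H2.
rewrite /total_increment -big_split/=; apply: ler_sum => p _.
have -> : f p.2 - g p.2 - (f p.1 - g p.1) = f p.2 - f p.1 - (g p.2 - g p.1).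
  by ring.
exact: ler_normB.
Qed.

(** The retraction of the line onto [[a, b]]. Composing with it extends a function by constants,
    keeps continuity and monotonicity, and discards the arbitrary values outside [[a, b]]. *)
Definition clamp a b (x : R) : R := Num.max a (Num.min x b).

Lemma clamp_itv a b x : a <= b -> a <= clamp a b x <= b.
Proof. by move=> ab; rewrite /clamp le_max lexx/= ge_max ab ge_min lexx orbT. Qed.

Lemma clamp_id a b x : a <= x <= b -> clamp a b x = x.
Proof. by move=> /andP[ax xb]; rewrite /clamp (min_idPl xb) (max_idPr ax). Qed.

Lemma clamp_nd a b : {homo clamp a b : x y / x <= y}.
Proof.
move=> x y xy; rewrite /clamp ge_max !le_max lexx/= orbC le_min !ge_min xy lexx.
by rewrite !orbT.
Qed.

Lemma clamp_contract a b x y : a <= b -> `|clamp a b x - clamp a b y| <= `|x - y|.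
Proof.
move=> ab; wlog xy : x y / x <= y => [H|].
  have [/H//|/ltW/H] := leP x y.
  by rewrite distrC (distrC y).
rewrite distrC (distrC x) !ger0_norm ?subr_ge0 ?clamp_nd//.
rewrite /clamp; case: (leP y b) => yb; case: (leP x b) => xb;
  case: (leP a _) => ax //=; try (case: (leP a _) => ay //=); lra.
Qed.

Lemma seq_ac_clamp_continuous a b f : a <= b -> seq_ac a b f ->
  continuous (f \o clamp a b).
Proof.
move=> ab acf x; apply/cvgrPdist_le => e e0; have [d d0 H] := acf e e0.
near=> y => /=; have : `|x - y| < d.
  by near: y; apply: cvgr_dist_lt => //; exact: cvg_id.
move=> /(le_lt_trans (clamp_contract x y ab)).
move: (clamp_itv x ab) (clamp_itv y ab).
move: (clamp a b x) (clamp a b y) => u v uab vab.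
wlog uv : u v uab vab / u <= v => [h|].
  have [/h|/ltW/h] := leP u v; first exact.
  by rewrite distrC (distrC (f v)); exact.
rewrite distrC ger0_norm ?subr_ge0// distrC => uvd.
have := H [:: (u, v)]; rewrite /total_increment /total_length !big_seq1/=; apply => //.
by rewrite /subinterval/= uv; move: uab vab => /andP[-> _] /andP[_ ->].
Unshelve. all: by end_near. Qed.

Lemma lebesgue_stieltjes_itv (F : cumulative R R) (u v : R) : u <= v ->
  lebesgue_stieltjes_measure F `]u, v]%classic = (F v - F u)%:E.
Proof.
move=> uv; rewrite /lebesgue_stieltjes_measure /measure_extension/=.
by rewrite measurable_mu_extE/= ?wlength_itv_bnd//; exact: is_ocitv.
Qed.

(** Half-open intervals, because on these the Stieltjes measure is an increment of [F] and adjacent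
    ones are disjoint. *)
Definition itvs_union s : set R := \big[setU/set0]_(p <- s) `]p.1, p.2]%classic.

Lemma measurable_itvs_union s : measurable (itvs_union s).
Proof. by apply: bigsetU_measurable => i _; exact: measurable_itv. Qed.

Lemma itvs_unionE s x : itvs_union s x <-> exists2 p, p \in s & p.1 < x <= p.2.
Proof.
rewrite /itvs_union -bigcup_seq; split => [[p /= ps]|[p ps xp]].
  by rewrite in_itv/=; exists p.
by exists p => //=; rewrite in_itv.
Qed.

Lemma lebesgue_itvs_union a b s : all (subinterval a b) s -> pairwise nonoverlapping s ->
  mu (itvs_union s) = (total_length s)%:E.
Proof.
rewrite /total_length /itvs_union.
elim: s => [_ _|p s ih]; first by rewrite !big_nil measure0.
move=> /= /andP[pab sab] /andP[ps pws]; rewrite !big_cons measureU//.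
- rewrite [RHS]EFinD; congr (_ + _)%E; last exact: ih.
  apply: etrans (lebesgue_measure_itv `]p.1, p.2]) _; rewrite /= lte_fin; case: ltP => // pp; move: pab => /and3P[_ p12 _].
  by congr EFin; apply/eqP; rewrite eq_sym subr_eq0 eq_le p12 pp.
- exact: measurable_itvs_union.
- apply/seteqP; split => // x [/= ]; rewrite in_itv/= => /andP[px xp].
  move=> /itvs_unionE[q qs /andP[qx xq]].
  by have /allP/(_ _ qs)/orP[|] := ps; lra.
Qed.

Lemma stieltjes_itvs_union_le (F : cumulative R R) a b s : all (subinterval a b) s ->
  (lebesgue_stieltjes_measure F (itvs_union s) <= (total_increment F s)%:E)%E.
Proof.
rewrite /total_increment /itvs_union.
elim: s => [_|p s ih]; first by rewrite !big_nil measure0.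
move=> /= /andP[/and3P[_ pp _] sab]; rewrite !big_cons EFinD.
have := @measureU2 _ _ _ (lebesgue_stieltjes_measure F) `]p.1, p.2]%classic (itvs_union s) _ _.
move=> /(_ (measurable_itv _) (measurable_itvs_union _))/le_trans; apply.
apply: leeD; last exact: ih.
by have := lebesgue_stieltjes_itv F pp => /= ->; rewrite lee_fin ler_norm.
Qed.

End AEDerivability.

(** * Dyadic exhaustion of open sets and Stieltjes null sets *)

Section MonotoneAC.
Context {R : realType}.
Local Notation mu := (@lebesgue_measure R).
Implicit Types (a b : R) (U : set R).

Definition dyadic a b n i : R := a + (b - a) * (i%:R / 2 ^+ n).

Lemma dyadic0 a b n : dyadic a b n 0 = a.
Proof. by rewrite /dyadic mul0r mulr0 addr0. Qed.

Lemma dyadic_max a b n : dyadic a b n (2 ^ n) = b.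
Proof. by rewrite /dyadic natrX divff ?expf_neq0// mulr1 addrC subrK. Qed.

Lemma dyadic_le a b n i j : a <= b -> (i <= j)%N -> dyadic a b n i <= dyadic a b n j.
Proof.
move=> ab ij; rewrite /dyadic lerD2l ler_wpM2l ?subr_ge0// ler_wpM2r//.
by rewrite ler_nat.
Qed.

Lemma dyadic_double a b n i : dyadic a b n.+1 i.*2 = dyadic a b n i.
Proof.
rewrite /dyadic -muln2 natrM exprS; congr (_ + _ * _).
by rewrite invfM mulrA mulfK.
Qed.

Lemma dyadic_step a b n i : dyadic a b n i.+1 - dyadic a b n i = (b - a) / 2 ^+ n.
Proof. by rewrite /dyadic -natr1; ring. Qed.

Definition dyadic_itvs a b U n : seq (R * R) :=
  [seq (dyadic a b n i, dyadic a b n i.+1) | i <- iota 0 (2 ^ n) &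
     `[< `]dyadic a b n i, dyadic a b n i.+1]%classic `<=` U >]].

Lemma dyadic_itvsP a b U n p : reflect
  (exists i, [/\ (i < 2 ^ n)%N, p = (dyadic a b n i, dyadic a b n i.+1) &
     `]dyadic a b n i, dyadic a b n i.+1]%classic `<=` U])
  (p \in dyadic_itvs a b U n).
Proof.
apply: (iffP mapP) => [[i]|[i [i2 -> iU]]].
  rewrite mem_filter mem_iota add0n => /andP[/asboolP iU i2] ->.
  by exists i; split.
exists i => //; rewrite mem_filter mem_iota add0n i2 !andbT.
exact/asboolP.
Qed.

Lemma dyadic_itvs_sub a b U n : a <= b -> all (subinterval a b) (dyadic_itvs a b U n).
Proof.
move=> ab; apply/allP => _ /dyadic_itvsP[i [i2 -> _]].
have := dyadic_le n ab (leq0n i); have := dyadic_le n ab i2.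
rewrite dyadic0 dyadic_max => h1 h2; apply/and3P; split => //=.
exact: dyadic_le.
Qed.

Lemma dyadic_itvs_pairwise a b U n : a <= b ->
  pairwise nonoverlapping (dyadic_itvs a b U n).
Proof.
move=> ab; rewrite /dyadic_itvs pairwise_map.
have := sorted_filter ltn_trans (fun i => `[< `]dyadic a b n i, dyadic a b n i.+1]%classic `<=` U >]) (iota_ltn_sorted 0 (2 ^ n)).
rewrite sorted_pairwise; last exact: ltn_trans.
apply: sub_pairwise => i j ij; rewrite /nonoverlapping/=.
by rewrite (dyadic_le n ab ij).
Qed.

Lemma dyadic_itvs_subset a b U n : itvs_union (dyadic_itvs a b U n) `<=` U.
Proof.
move=> x /itvs_unionE[_ /dyadic_itvsP[i [_ -> iU]] /= xi].
by apply: iU; rewrite /= in_itv.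
Qed.

(** A cell of level [n] is the union of the cells [i.*2] and [i.*2.+1] of the next level, and both
    lie in [U] along with it. *)
Lemma dyadic_itvs_nondecreasing a b U :
  nondecreasing_seq (fun n => itvs_union (dyadic_itvs a b U n)).
Proof.
apply/nondecreasing_seqP => n; apply/subsetPset => x.
move=> /itvs_unionE[_ /dyadic_itvsP[i [i2 -> iU]] /= /andP[ix xi]].
have e0 : dyadic a b n.+1 i.*2 = dyadic a b n i by rewrite dyadic_double.
have e2 : dyadic a b n.+1 i.*2.+2 = dyadic a b n i.+1.
  by rewrite -doubleS dyadic_double.
have st := dyadic_step a b n.+1 i.*2; have st1 := dyadic_step a b n.+1 i.*2.+1.
apply/itvs_unionE; have [xm|xm] := leP x (dyadic a b n.+1 i.*2.+1).
- exists (dyadic a b n.+1 i.*2, dyadic a b n.+1 i.*2.+1); last by rewrite /= e0 ix.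
  apply/dyadic_itvsP; exists i.*2; split => //.
    by rewrite expnS mul2n ltn_double.
  move=> z /=; rewrite in_itv/= => zi; apply: iU; rewrite /= in_itv/=; lra.
- exists (dyadic a b n.+1 i.*2.+1, dyadic a b n.+1 i.*2.+2); last by rewrite /= e2 xm.
  apply/dyadic_itvsP; exists i.*2.+1; split => //.
    by rewrite expnS mul2n ltn_Sdouble.
  move=> z /=; rewrite in_itv/= => zi; apply: iU; rewrite /= in_itv/=; lra.
Qed.

(** Once the cells are shorter than the radius of a ball around [x] inside [U], the cell that
    contains [x] lies in that ball. *)
Lemma dyadic_itvs_cover a b U : a < b -> open U ->
  U `&` `]a, b]%classic `<=` \bigcup_n itvs_union (dyadic_itvs a b U n).
Proof.
move=> ab oU x [Ux] /=; rewrite in_itv/= => /andP[ax xb].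
have /nbhs_ballP[r /= r0 rU] : nbhs x U by exact: open_nbhs_nbhs.
have ba0 : 0 < b - a by rewrite subr_gt0.
(* Since [n + 1 <= 2 ^ n], the cell width is at most [(b - a) / (n + 1)], which is below [r]. *)
pose n := Num.truncn ((b - a) / r).
have nr : (b - a) / 2 ^+ n < r.
  rewrite ltr_pdivrMr ?exprn_gt0// mulrC -ltr_pdivrMr//.
  apply: (@lt_le_trans _ _ n.+1%:R); first exact: truncnS_gt.
  by rewrite -natrX ler_nat ltn_expl.
have exi : exists i, x <= dyadic a b n i.+1.
  by exists (2 ^ n)%N; rewrite (le_trans xb)// -{1}(dyadic_max a b n) dyadic_le// ltW.
(* Minimality of [i] puts [x] strictly to the right of the left end of the cell; for [i = 0] this is
   the assumption [a < x]. *)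
case: (ex_minnP exi) => i xi imin; exists n => //; apply/itvs_unionE.
have ix : dyadic a b n i < x.
  case: i xi imin => [_ _|i xi imin]; first by rewrite dyadic0.
  by rewrite ltNge; apply/negP => /imin; rewrite ltnn.
exists (dyadic a b n i, dyadic a b n i.+1); last by rewrite /= ix xi.
apply/dyadic_itvsP; exists i; split => //.
  rewrite ltnNge; apply/negP => /(dyadic_le n (ltW ab)).
  by rewrite dyadic_max; apply/negP; rewrite -ltNge (lt_le_trans ix).
move=> z /=; rewrite in_itv/= => zi; apply: rU; rewrite /ball/=.
have := dyadic_step a b n i; move: nr; set h := (b - a) / _ => nr st.
by rewrite ltr_distl; apply/andP; split; lra.
Qed.

(* A Lebesgue-null set lies in an open set of small measure; the finite unions of dyadic
   intervals inside that open set have small Stieltjes measure and exhaust it. *)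
Lemma stieltjes_null (F : cumulative R R) a b : a < b -> seq_ac a b F ->
  forall A, measurable A -> mu A = 0%E ->
    lebesgue_stieltjes_measure F (A `&` `]a, b]%classic) = 0%E.
Proof.
move=> ab acF A mA muA0; apply/eqP; rewrite eq_le measure_ge0 andbT.
apply/lee_addgt0Pr => e e0; rewrite add0e.
have [d d0 H] := acF e e0.
have muAoo : (mu A < +oo)%E by rewrite muA0 ltry.
have [U [oU AU UA]] := lebesgue_regularity_outer mA muAoo d0.
have mU : measurable U := open_measurable oU.
have Ud : (mu U < d%:E)%E.
  have mUA : measurable (U `\` A) by exact: measurableD.
  apply: le_lt_trans UA; rewrite -[leRHS]add0e -muA0.
  have := @measureU2 _ _ _ mu A (U `\` A) mA mUA.
  apply: le_trans; apply: le_measure; rewrite ?inE//.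
    exact: measurableU.
  by move=> x Ux; case: (pselect (A x)); [left|right].
pose E n := itvs_union (dyadic_itvs a b U n).
have mE n : measurable (E n) by exact: measurable_itvs_union.
have mUE : measurable (\bigcup_n E n) by apply: bigcup_measurable => n _.
apply: (@le_trans _ _ (lebesgue_stieltjes_measure F (\bigcup_n E n))).
  apply: le_measure; rewrite ?inE//; first exact: measurableI.
  by apply: subset_trans (dyadic_itvs_cover ab oU); apply: setSI.
have cvgE := @nondecreasing_cvg_mu _ _ _ (lebesgue_stieltjes_measure F) E mE
  mUE (dyadic_itvs_nondecreasing a b U).
rewrite -(cvg_lim _ cvgE)//; apply: lime_le; first by apply/cvg_ex; eexists; exact: cvgE.
apply: nearW => n /=.
have sub := dyadic_itvs_sub U n (ltW ab).
have pw := dyadic_itvs_pairwise U n (ltW ab).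
apply: le_trans (stieltjes_itvs_union_le F sub) _.
rewrite lee_fin; apply: H => //.
rewrite -lte_fin -(lebesgue_itvs_union sub pw).
by apply: le_lt_trans Ud; apply: le_measure; rewrite ?inE//;
  [exact: measurable_itvs_union|exact: dyadic_itvs_subset].
Qed.

End MonotoneAC.

(** * Almost everywhere derivability of absolutely continuous functions *)

Section ACDerivable.
Context {R : realType}.
Local Notation mu := (@lebesgue_measure R).
Local Notation TV := total_variation.
Implicit Types (a b : R) (f : R -> R).

Lemma derivable_shift (f : R -> R) (c x : R) :
  derivable f x 1 -> derivable (fun t => f t + c) x 1.
Proof. by move=> df; apply: (derivableD df (g := cst c)); exact: derivable_cst. Qed.

(* The Stieltjes measure of [f] has a Radon-Nikodym density, so [f] is an indefinite integral. *)
Lemma monotone_seq_ac_derivable_ae a b f : a < b -> seq_ac a b f ->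
  {in `[a, b] &, {homo f : x y / x <= y}} ->
  {ae mu, forall x, x \in `]a, b[ -> derivable f x 1}.
Proof.
move=> ab acf ndf; have leab := ltW ab.
pose F0 : R -> R := f \o clamp a b.
have F0nd : {homo F0 : x y / x <= y}.
  by move=> x y xy; apply: ndf; rewrite ?in_itv/= ?clamp_itv// clamp_nd.
have F0rc : right_continuous F0.
  by apply/right_continuousW; exact: seq_ac_clamp_continuous.
pose F : cumulative R R := HB.pack F0 (isCumulative.Build R _ R F0 F0nd F0rc).
have FE x : a <= x <= b -> F x = f x by move=> xab; rewrite /= /F0/= clamp_id.
have acF : seq_ac a b F.
  move=> e /acf[d d0 H]; exists d => // s sab sep len.
  apply: le_trans (H s sab sep len); rewrite /total_increment big_seq [leRHS]big_seq.
  apply: ler_sum => p /(allP sab)/and3P[ap pp pb].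
  by rewrite !FE//; lra.
have mD : measurable (`]a, b]%classic : set (measurableTypeR R)) by exact: measurable_itv.
have nuD : (lebesgue_stieltjes_measure F `]a, b]%classic < +oo)%E.
  by have := lebesgue_stieltjes_itv F leab => /= ->; rewrite ltry.
(* The restriction to []a, b]] is a finite measure, of total mass [F b - F a]. *)
pose nu : {finite_measure set (measurableTypeR R) -> \bar R} :=
  @mfrestr _ (measurableTypeR R) R _ (lebesgue_stieltjes_measure F) mD nuD.
have numu : nu `<< (mu : {measure set (measurableTypeR R) -> \bar R}).
  apply/null_content_dominatesP => A mA muA.
  exact: (stieltjes_null ab acF mA muA).
have [g [g0 gfin gint gE]] := radon_nikodym_sigma_finite numu.
pose h : R -> R := fine \o g.
have hE : EFin \o h = g by apply/funext => x; rewrite /h/= fineK.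
have hint : mu.-integrable [set: R] (EFin \o h) by rewrite hE.
have hloc : locally_integrable [set: R] h.
  by apply: open_integrable_locally => //; exact: openT.
have hintI y : mu.-integrable [set` Interval (BRight a) (BRight y)] (EFin \o h).
  exact: integrableS hint.
(* Lebesgue differentiation: the indefinite integral of the density is derivable at almost every
   point. *)
have := FTC1 hintI hloc.
apply: filterS; first exact: (ae_filter_ringOfSetsType mu).
move=> x H.
rewrite in_itv/= => /andP[ax xb].
have [Hd _] := H ax.
have FI y : a <= y <= b -> F y = \int[mu]_(t in `]a, y]) h t + F a.
  move=> /andP[ay yb]; rewrite /Rintegral -/(EFin \o h) hE.
  rewrite -(gE `]a, y]%classic)//= /mfrestr/= /mrestr/= setIidl; last first.
    by move=> t /=; rewrite !in_itv/=; lra.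
  by have := lebesgue_stieltjes_itv F ay => /= ->; rewrite subrK.
(* Derivability is local, and near an interior point [f] is this indefinite integral plus the
   constant [F a]. *)
suff : derivable (fun y => \int[mu]_(t in `]a, y]) h t + F a) x 1.
  apply: near_eq_derivable; near=> y.
  have yab : a <= y <= b.
    apply/andP; split; apply: ltW; near: y; [exact: lt_nbhsr|exact: lt_nbhsl].
  by rewrite -FI// FE.
exact: (@derivable_shift _ (F a) _ Hd).
Unshelve. all: by end_near. Qed.

(** Jordan decomposition [f = v - (v - f)], with [v] the variation from [a]. Over an interval [v]
    grows by at least the increment of [f], so both terms are nondecreasing; both are also
    absolutely continuous. *)
Lemma seq_ac_derivable_ae a b f : a < b -> seq_ac a b f ->
  {ae mu, forall x, x \in `]a, b[ -> derivable f x 1}.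
Proof.
move=> ab acf; pose v x := fine (TV a x f).
have TVfin x y : a <= x -> x <= y -> y <= b -> TV x y f \is a fin_num.
  move=> ax xy yb; apply: seq_ac_total_variation_fin => // e /acf[d d0 H].
  exists d => // s sxy; apply: H; apply: sub_all sxy => q /and3P[q1 q2 q3].
  by apply/and3P; split => //; lra.
have vD x y : a <= x -> x <= y -> y <= b -> v y = v x + fine (TV x y f).
  move=> ax xy yb; rewrite /v (@total_variationD _ a y x)// fineD ?TVfin//.
  exact: le_trans yb.
have acv : seq_ac a b v by exact: seq_ac_total_variation.
have ndv : {in `[a, b] &, {homo v : x y / x <= y}}.
  move=> x y; rewrite !in_itv/= => /andP[ax _] /andP[_ yb] xy.
  by rewrite (vD x y)// lerDl fine_ge0// total_variation_ge0.
have ndw : {in `[a, b] &, {homo (v \- f) : x y / x <= y}}.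
  move=> x y; rewrite !in_itv/= => /andP[ax _] /andP[_ yb] xy.
  rewrite (vD x y)//; have := total_variation_ge f xy.
  rewrite -[TV x y f]fineK ?TVfin// lee_fin => h.
  by have := ler_norm (f y - f x); lra.
have Dv := monotone_seq_ac_derivable_ae ab acv ndv.
have Dw := monotone_seq_ac_derivable_ae ab (seq_acB acv acf) ndw.
have aeF : Filter (almost_everywhere mu) := ae_filter_ringOfSetsType mu.
move: (filterI (Filter := aeF) Dv Dw).
apply: filterS.
move=> x [dv dw] xab.
have -> : f = v \- (v \- f) by apply/funext => z /=; ring.
exact: derivableB (dv xab) (dw xab).
Qed.

End ACDerivable.

(** * Borel measurability of the derivative *)

Section Derive1Measurable.
Context {R : realType}.
Local Notation mu := (@lebesgue_measure R).
Implicit Types (a b e d x : R) (f : R -> R).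

Definition diff_quot f (r x : R) : R := r^-1 * (f (r + x) - f x).

Lemma dnbhs0P (P : R -> Prop) : (\forall h \near 0^', P h) <->
  exists2 d : R, 0 < d & forall h, h != 0 -> `|h| < d -> P h.
Proof.
split=> [/nbhs_ballP[d /= d0 H]|[d d0 H]].
  by exists d => // h h0 hd; apply: H => //; rewrite /ball/= sub0r normrN.
near=> h; apply: H; near: h; [exact: nbhs_dnbhs_neq|exact: dnbhs0_lt].
Unshelve. all: by end_near. Qed.

Lemma derivable_diff_quot f x :
  derivable f x 1 <-> cvg (diff_quot f h x @[h --> 0^']).
Proof.
rewrite /derivable /diff_quot.
have -> // : (fun h : R => h^-1 *: ((f \o shift x) (h *: (1 : R)) - f x)) =
             (fun h => h^-1 * (f (h + x) - f x)).
by apply/funext => h /=; rewrite /GRing.scale/= mulr1.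
Qed.

(** A Cauchy condition on the difference quotients: it does not mention the value of the limit, and
    for continuous [f] it is an intersection of closed conditions on [x]. *)
Definition quot_close f e d : set R :=
  [set x | forall p : R * R, 0 < `|p.1| < d /\ 0 < `|p.2| < d ->
    `|diff_quot f p.1 x - diff_quot f p.2 x| <= e].

Lemma continuous_diff_quot f r : continuous f -> continuous (diff_quot f r).
Proof.
move=> cf x; apply: cvgM; first exact: cvg_cst.
apply: cvgB; last exact: cf.
apply: continuous_comp; last exact: cf.
by apply: cvgD; [exact: cvg_cst|exact: cvg_id].
Qed.

Lemma closed_quot_close f e d : continuous f -> closed (quot_close f e d).
Proof.
move=> cf; have -> : quot_close f e d =
    \bigcap_(p in [set p : R * R | 0 < `|p.1| < d /\ 0 < `|p.2| < d])
      ((fun x => `|diff_quot f p.1 x - diff_quot f p.2 x|) @^-1` [set z | z <= e]).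
  by [].
apply: closed_bigI => p _; apply: closed_comp; last exact: closed_le.
move=> x _; apply: cvg_norm; apply: cvgB; exact: continuous_diff_quot.
Qed.

Lemma derivable_quot_close f x : derivable f x 1 <->
  forall n, exists m, quot_close f n.+1%:R^-1 m.+1%:R^-1 x.
Proof.
rewrite derivable_diff_quot; split.
- move=> /cvg_ex[l /cvgrPdist_lt fl] n.
  have n0 : 0 < n.+1%:R^-1 / 2 :> R by rewrite divr_gt0// invr_gt0.
  move: (n.+1%:R^-1) n0 => e n0.
  have /dnbhs0P[d d0 H] := fl _ n0.
  exists (Num.truncn d^-1) => -[r s] /= [/andP[r0 rm] /andP[s0 sm]].
  have dm : (Num.truncn d^-1).+1%:R^-1 < d.
    by rewrite invf_plt ?posrE//; exact: truncnS_gt.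
  have := H r; rewrite -normr_gt0 => /(_ r0 (lt_trans rm dm)).
  have := H s; rewrite -normr_gt0 => /(_ s0 (lt_trans sm dm)).
  by rewrite !ltr_distl ler_distl => /andP[? ?] /andP[? ?]; apply/andP; split; lra.
- move=> H; apply: cauchy_cvg; apply: cauchy_exP => e e0.
  have [m Hm] := H (Num.truncn e^-1).
  have ne : (Num.truncn e^-1).+1%:R^-1 < e.
    by rewrite invf_plt ?posrE//; exact: truncnS_gt.
  (* Any one step shorter than [m.+1%:R^-1] can serve as centre: the quotients for all such steps
     lie within [e] of its quotient. *)
  pose r : R := m.+1%:R^-1 / 2.
  have m0 : 0 < m.+1%:R^-1 :> R by rewrite invr_gt0.
  have r0 : 0 < r by rewrite divr_gt0.
  have rm : r < m.+1%:R^-1 by rewrite /r ltr_pdivrMr// ltr_pMr// ltr1n.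
  exists (diff_quot f r x); apply/dnbhs0P; exists m.+1%:R^-1 => // h h0 hm.
  apply: le_lt_trans ne; apply: (Hm (r, h)) => /=.
  split; last by rewrite normr_gt0 h0 hm.
  by rewrite gtr0_norm ?r0.
Qed.

Lemma measurable_derivable f : continuous f ->
  measurable [set x | derivable f x 1].
Proof.
move=> cf; have -> : [set x | derivable f x 1] =
    \bigcap_n \bigcup_m quot_close f n.+1%:R^-1 m.+1%:R^-1.
  apply/seteqP; split=> x /= => [/derivable_quot_close H n _|H].
    by have [m Hm] := H n; exists m.
  by apply/derivable_quot_close => n; have [m _ Hm] := H n I; exists m.
apply: bigcap_measurable => // n _; apply: bigcup_measurable => m _.
by apply: closed_measurable; exact: closed_quot_close.
Qed.

(* At a point of non-differentiability [derive1 f] is the junk value [point]. *)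
Lemma measurable_derive1 f : continuous f -> measurable_fun setT (derive1 f).
Proof.
move=> cf; pose D := [set x | derivable f x 1].
have mD : measurable D by exact: measurable_derivable.
(* Difference quotients may converge along [n.+1%:R^-1] even where [f] is not derivable, so off [D]
   they are replaced by the default value; the sequence then tends to [derive1 f] everywhere. *)
pose g n x := \1_D x * diff_quot f n.+1%:R^-1 x + \1_(~` D) x * (point : R).
apply: (@measurable_fun_cvg _ _ _ _ g).
- move=> n; apply: measurable_funD; apply: measurable_funM => //.
  + by apply: continuous_measurable_fun; exact: continuous_diff_quot.
  + by apply: measurable_indic; exact: measurableC.
- move=> x _; have [Dx|nDx] := pselect (D x); last first.
    have -> : derive1 f x = point.
      apply: dvgP; move: nDx; rewrite /D/= derivable_diff_quot.
      by apply: contra_not.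
    have -> : (fun n => g n x) = cst point; last exact: cvg_cst.
    by apply/funext => n; rewrite /g !indicE memNset// mem_set//= mul0r add0r mul1r.
  have -> : (fun n => g n x) = (fun n => diff_quot f n.+1%:R^-1 x).
    apply/funext => n; rewrite /g !indicE mem_set// memNset; last by apply.
    by rewrite mul0r addr0 mul1r.
  have cq : diff_quot f h x @[h --> 0^'] --> derive1 f x.
    by move: (Dx); rewrite /D/= derivable_diff_quot.
  apply: (cvg_comp _ _ _ cq) => A /dnbhs0P[d d0 dA].
  exists (Num.truncn d^-1) => // n /= dn; apply: dA; first by rewrite invr_neq0.
  rewrite gtr0_norm ?invr_gt0// invf_plt ?posrE//.
  by apply: lt_le_trans (truncnS_gt _) _; rewrite ler_nat.
Qed.

Lemma derive1_near f g x : {near x, f =1 g} -> derive1 f x = derive1 g x.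
Proof. by move=> fg; rewrite !derive1E; exact: near_eq_derive. Qed.

(** The clamped extension is continuous on the line and coincides with [f] near each interior point,
    so the derivatives agree there; adding the two end points does not affect measurability. *)
Lemma measurable_derive1_itv f a b : a < b -> seq_ac a b f ->
  measurable_fun `[a, b] (derive1 f).
Proof.
move=> ab acf; apply/measurable_fun_itv_obnd_cbndP/measurable_fun_itv_bndo_bndcP.
have := measurable_derive1 (seq_ac_clamp_continuous (ltW ab) acf).
move/(measurable_funS measurableT (@subsetT _ `]a, b[%classic)).
apply: eq_measurable_fun => x; rewrite inE/= in_itv/= => /andP[ax xb].
apply: derive1_near; near=> z => /=; rewrite clamp_id//.
by apply/andP; split; apply: ltW; near: z; [exact: lt_nbhsr|exact: lt_nbhsl].
Unshelve. all: by end_near. Qed.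

Lemma derive1D_ae a b f k : a < b -> seq_ac a b f -> (forall x, derivable k x 1) ->
  {ae mu, forall x, x \in `]a, b[ ->
    derive1 (f \+ k) x = derive1 f x + derive1 k x}.
Proof.
move=> ab acf dk; have := seq_ac_derivable_ae ab acf.
apply: filterS; first exact: (ae_filter_ringOfSetsType mu).
move=> x fx xab; rewrite !derive1E; apply: deriveD => //.
exact: fx.
Qed.

End Derive1Measurable.

(** * The weakly singular kernel *)

Section AbelKernel.
Context {R : realType}.
Local Notation mu := (@lebesgue_measure R).
Implicit Types (gam s M : R).

(** The explicit cut-off is there because [powR] does not vanish at a negative base. At [s = 0] it
    agrees with [powR] as soon as [gam != 0]. *)
Definition abel_kernel gam s : R := if 0 < s then s `^ (- gam) else 0.

Lemma abel_kernel_ge0 gam s : 0 <= abel_kernel gam s.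
Proof. by rewrite /abel_kernel; case: ifPn => // _; exact: powR_ge0. Qed.

Lemma measurable_abel_kernel gam : measurable_fun setT (abel_kernel gam).
Proof.
apply: measurable_fun_ifT => //.
by apply: measurable_fun_ltr.
Qed.

(** The antiderivative [s^(1 - gam) / (1 - gam)] is nonnegative at [u], so dropping that term leaves
    a bound independent of [u], ready for the limit at the singularity. *)
Lemma integral_abel_kernel_away gam M (u : R) : gam < 1 -> 0 < u -> u <= M ->
  (\int[mu]_(s in `[u, M]) (abel_kernel gam s)%:E <=
    (M `^ (1 - gam) / (1 - gam))%:E)%E.
Proof.
move=> g1 u0; rewrite le_eqVlt => /predU1P[<-|uM].
  by rewrite set_itv1 integral_set1 lee_fin divr_ge0 ?powR_ge0// subr_ge0 ltW.
have g0 : 1 - gam != 0 by rewrite gt_eqF// subr_gt0.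
pose F (x : R) := (1 - gam)^-1 * x `^ (1 - gam).
have dP x : 0 < x -> derivable (fun y : R => y `^ (1 - gam)) x 1.
  by move=> x0; apply: derivable_powR; rewrite in_itv/= x0.
have dF x : 0 < x -> derivable F x 1.
  move=> x0; apply: derivableM; [exact: derivable_cst|exact: dP].
have cF x : 0 < x -> {for x, continuous F}.
  move=> /dF; rewrite derivable1_diffP; exact: differentiable_continuous.
have F'E x : 0 < x -> derive1 F x = x `^ (- gam).
  move=> x0; rewrite derive1Ml//; last exact: dP.
  rewrite powR_derive1 ?in_itv/= ?x0// mulrA mulVf// mul1r.
  by congr (_ `^ _); ring.
have -> : (\int[mu]_(s in `[u, M]) (abel_kernel gam s)%:E =
           \int[mu]_(s in `[u, M]) (s `^ (- gam))%:E)%E.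
  apply: eq_integral => s; rewrite inE/= in_itv/= => /andP[us _].
  by rewrite /abel_kernel (lt_le_trans u0 us).
rewrite (continuous_FTC2 uM (F := F)).
- rewrite -EFinB lee_fin {1}/F mulrC lerBlDr lerDl.
  by rewrite mulr_ge0 ?powR_ge0// invr_ge0 subr_ge0 ltW.
- apply: derivable_within_continuous => x; rewrite in_itv/= => /andP[ux _].
  by apply: derivable_powR; rewrite in_itv/= (lt_le_trans u0 ux).
- split=> [x|  |].
  + by rewrite in_itv/= => /andP[ux _]; apply: dF; exact: lt_trans ux.
  + by apply: cvg_at_right_filter; exact: cF.
  + by apply: cvg_at_left_filter; apply: cF; exact: lt_trans uM.
- by move=> x; rewrite in_itv/= => /andP[ux _]; rewrite F'E// (lt_trans u0).
Qed.

(** The fundamental theorem stops short of the singularity, so []0, M]] is exhausted by the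
    intervals [[1 / (n + 1), M]] and monotone convergence gives the rest. The interval is symmetric
    because [x - t] takes both signs on [[a, b]]. *)
Lemma integrable_abel_kernel gam M : gam < 1 -> 0 < M ->
  mu.-integrable `[- M, M] (EFin \o abel_kernel gam).
Proof.
move=> g1 M0; have mk := @measurable_abel_kernel gam.
apply/integrableP; split.
  by apply/measurable_EFinP; exact: measurable_funS mk.
under eq_integral do rewrite gee0_abs ?lee_fin ?abel_kernel_ge0//.
have mE (A : set R) : measurable_fun A (fun s => (abel_kernel gam s)%:E).
  by apply/measurable_EFinP; exact: measurable_funS mk.
have -> : `[- M, M]%classic = `[- M, 0]%classic `|` `]0, M]%classic.
  by rewrite -itv_bndbnd_setU// bnd_simp; lra.
rewrite ge0_integral_setU//=; last 2 first.
- by move=> s _; rewrite lee_fin abel_kernel_ge0.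
- by apply/disj_setPS => s [/=]; rewrite !in_itv/=; lra.
rewrite [X in (X + _)%E](_ : _ = 0%E) ?add0e; last first.
  rewrite integral0_eq// => s; rewrite /= in_itv/= => /andP[_ s0].
  by rewrite /abel_kernel ltNge s0.
pose F n := `[n.+1%:R^-1, M]%classic : set (measurableTypeR R).
have -> : `]0, M]%classic = \bigcup_n F n.
  apply/seteqP; split=> s /= => [|[n _]]; rewrite /F/= !in_itv/= => /andP[s0 sM].
    exists (Num.truncn s^-1) => //=; rewrite in_itv/= sM andbT.
    by rewrite invf_ple ?posrE//; apply/ltW/truncnS_gt.
  by rewrite sM andbT (lt_le_trans _ s0)// invr_gt0.
have nF : nondecreasing_seq F.
  move=> m n mn; apply/subsetPset => s; rewrite /F/= !in_itv/= => /andP[ms ->].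
  by rewrite andbT (le_trans _ ms)// lef_pV2 ?posrE// ler_nat.
have cvgF : (\int[mu]_(s in F i) (abel_kernel gam s)%:E)%E @[i --> \oo] -->
    (\int[mu]_(s in \bigcup_i F i) (abel_kernel gam s)%:E)%E.
  have mF n : measurable (F n) by exact: measurable_itv.
  apply: (ge0_nondecreasing_set_cvg_integral nF mF) => [n|n s _].
  - exact: mE.
  - by rewrite lee_fin abel_kernel_ge0.
rewrite -(cvg_lim _ cvgF)//.
apply: (@le_lt_trans _ _ (M `^ (1 - gam) / (1 - gam))%:E); last exact: ltry.
apply: lime_le; first by apply/cvg_ex; eexists; exact: cvgF.
apply: nearW => n; have [uM|Mu] := leP n.+1%:R^-1 M.
  by apply: integral_abel_kernel_away => //; rewrite invr_gt0.
rewrite /F set_itv_ge; last by rewrite bnd_simp -ltNge.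
by rewrite integral_set0 lee_fin divr_ge0 ?powR_ge0// subr_ge0 ltW.
exact: mE.
Qed.

End AbelKernel.

(** * Abel integrals of both orientations, as convolutions *)

Section AbelIntegral.
Context {R : realType}.
Local Notation mu := (@lebesgue_measure R).
Implicit Types (a b gam e x s t : R) (f phi : R -> R).

Definition oriented_dist e x t : R := e * (x - t).

(* [e = 1] gives the left integral and [e = -1] the right one; the kernel vanishes on
   the other side of [x], so both integrals extend over the whole of [a, b]. *)
Definition abel_int e gam a b f x : R :=
  \int[mu]_(t in `[a, b]) (abel_kernel gam (oriented_dist e x t) * f t).

Lemma integrable_mul_bounded (D : set R) (k h : R -> R) C : measurable D ->
  mu.-integrable D (EFin \o k) -> measurable_fun D h -> (forall t, D t -> `|h t| <= C) ->
  mu.-integrable D (fun t => (k t * h t)%:E).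
Proof.
move=> mD ik mh hC; apply: (integrableMl _ ik mh) => //.
by exists C; split; [exact: num_real|move=> M CM t Dt; exact: le_trans (hC t Dt) (ltW CM)].
Qed.

Lemma measurable_oriented_dist e x : measurable_fun setT (oriented_dist e x).
Proof. by apply: measurable_funM => //; apply: measurable_funB. Qed.

(** A reflection ([e = 1]) or a translation ([e = -1]) preserves the length of intervals, and a
    measure is determined by its values on the half-open ones. *)
Lemma lebesgue_measure_oriented_dist e x (A : set R) : e = 1 \/ e = -1 -> measurable A ->
  pushforward mu (oriented_dist e x : _ -> measurableTypeR R) A = mu A.
Proof.
move=> he mA; apply/esym/lebesgue_measure_unique => //=.
  exact: measurable_oriented_dist.
move=> mf _ [[u v]] _ <-; rewrite /pushforward.
case: he => ->.
- have -> : oriented_dist 1 x @^-1` `]u, v]%classic = `[x - v, x - u[%classic.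
    by apply/seteqP; split=> t; rewrite /oriented_dist/= mul1r !in_itv/=; lra.
  rewrite !lebesgue_measure_itv/= !lte_fin ltrD2l ltrN2; case: ifP => // _.
  by rewrite -!EFinB; apply: (congr1 EFin); ring.
- have -> : oriented_dist (-1) x @^-1` `]u, v]%classic = `]x + u, x + v]%classic.
    by apply/seteqP; split=> t; rewrite /oriented_dist/= mulN1r !in_itv/=; lra.
  rewrite !lebesgue_measure_itv/= !lte_fin ltrD2l; case: ifP => // _.
  by rewrite -!EFinB; apply: (congr1 EFin); ring.
Qed.

Lemma ge0_integral_oriented_dist e x (f : R -> \bar R) (D : set R) :
  e = 1 \/ e = -1 -> measurable D -> measurable_fun D f -> (forall y, (0 <= f y)%E) ->
  (\int[mu]_(y in D) f y = \int[mu]_(t in oriented_dist e x @^-1` D) f (oriented_dist e x t))%E.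
Proof.
move=> he mD mf f0; have md : measurable_fun setT
    (oriented_dist e x : measurableTypeR R -> measurableTypeR R).
  exact: measurable_oriented_dist.
rewrite -(ge0_integral_pushforward md)//.
by apply: eq_measure_integral => //= A mA AS; exact/esym/lebesgue_measure_oriented_dist.
Qed.

Lemma measurable_preimage_oriented_dist e x (D : set R) : measurable D ->
  measurable (oriented_dist e x @^-1` D).
Proof.
by move=> mD; rewrite -[X in measurable X]setTI; exact: measurable_oriented_dist.
Qed.

Lemma integrable_oriented_dist e x f (D : set R) :
  e = 1 \/ e = -1 -> measurable D -> measurable_fun setT f ->
  mu.-integrable D (EFin \o f) ->
  mu.-integrable (oriented_dist e x @^-1` D) (EFin \o (f \o oriented_dist e x)).
Proof.
move=> he mD mf /integrableP[mfD foo]; apply/integrableP; split.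
  apply/measurable_EFinP; apply: measurable_funTS.
  by apply: measurableT_comp => //; exact: measurable_oriented_dist.
move: foo; rewrite (@ge0_integral_oriented_dist e x (fun y => `|(EFin \o f) y|%E))//.
exact: measurableT_comp.
Qed.

Lemma Rintegral_oriented_dist e x f (D : set R) :
  e = 1 \/ e = -1 -> measurable D -> measurable_fun setT f ->
  mu.-integrable D (EFin \o f) ->
  \int[mu]_(y in D) f y = \int[mu]_(t in oriented_dist e x @^-1` D) f (oriented_dist e x t).
Proof.
move=> he mD mf fD; congr fine.
have md : measurable_fun setT
    (oriented_dist e x : measurableTypeR R -> measurableTypeR R).
  exact: measurable_oriented_dist.
have mEf : measurable_fun setT (EFin \o f) by exact/measurable_EFinP.
have If := integrable_oriented_dist x he mD mf fD.
have := integral_pushforward md mEf If mD.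
move=> /= <-.
by apply: eq_measure_integral => //= A mA AS; exact/esym/lebesgue_measure_oriented_dist.
Qed.

Lemma oriented_dist_itv e x a b t : e = 1 \/ e = -1 -> x \in `[a, b] -> t \in `[a, b] ->
  - (b - a) <= oriented_dist e x t <= b - a.
Proof.
rewrite /oriented_dist !in_itv/= => -[->|->] /andP[? ?] /andP[? ?];
  rewrite ?mul1r ?mulN1r; lra.
Qed.

Lemma integrable_abel_kernel_shift e gam a b x : e = 1 \/ e = -1 -> gam < 1 -> a < b ->
  x \in `[a, b] -> mu.-integrable `[a, b] (EFin \o (abel_kernel gam \o oriented_dist e x)).
Proof.
move=> he g1 ab xab; have ba : 0 < b - a by rewrite subr_gt0.
have mD : measurable (`[- (b - a), b - a]%classic : set R) by exact: measurable_itv.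
have := integrable_oriented_dist x he mD (@measurable_abel_kernel R gam)
  (integrable_abel_kernel g1 ba).
apply: integrableS => //; first exact: measurable_preimage_oriented_dist.
by move=> t tab; rewrite /= in_itv/=; exact: oriented_dist_itv.
Qed.

Lemma integrable_abel e gam a b x f : e = 1 \/ e = -1 -> gam < 1 -> a < b ->
  x \in `[a, b] -> measurable_fun `[a, b] f ->
  (exists C, forall t, t \in `[a, b] -> `|f t| <= C) ->
  mu.-integrable `[a, b] (fun t => (abel_kernel gam (oriented_dist e x t) * f t)%:E).
Proof.
move=> he g1 ab xab mf [C fC].
apply: (integrable_mul_bounded (C := C) _ (integrable_abel_kernel_shift he g1 ab xab) mf).
  exact: measurable_itv.
exact: fC.
Qed.

(** The right-hand side does not depend on [x]; this uniformity makes the double integral in the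
    Fubini argument finite. *)
Lemma integral_abel_kernel_shift_le e gam a b x : e = 1 \/ e = -1 -> a < b ->
  x \in `[a, b] ->
  (\int[mu]_(t in `[a, b]) (abel_kernel gam (oriented_dist e x t))%:E <=
   \int[mu]_(s in `[(- (b - a))%R, (b - a)%R]) (abel_kernel gam s)%:E)%E.
Proof.
move=> he ab xab; have mk := @measurable_abel_kernel R gam.
rewrite (@ge0_integral_oriented_dist e x (fun s => (abel_kernel gam s)%:E))//; last 2 first.
- by apply/measurable_EFinP; exact: measurable_funTS.
- by move=> s; rewrite lee_fin abel_kernel_ge0.
apply: ge0_subset_integral => //.
- by apply: measurable_preimage_oriented_dist; exact: measurable_itv.
- apply/measurable_EFinP; apply: measurable_funTS.
  by apply: measurableT_comp => //; exact: measurable_oriented_dist.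
- by move=> s _; rewrite lee_fin abel_kernel_ge0.
- by move=> t tab; rewrite /= in_itv/=; exact: oriented_dist_itv.
Qed.

Lemma oriented_distK e x : e = 1 \/ e = -1 -> cancel (oriented_dist e x) (fun s => x - e * s).
Proof. by rewrite /oriented_dist => -[->|->] t; ring. Qed.

Lemma bounded_supported a b phi : continuous phi ->
  (forall t, t \notin `[a, b] -> phi t = 0) -> exists C, forall t, `|phi t| <= C.
Proof.
move=> cphi phi0; have cphi' : {within `[a, b], continuous phi}.
  exact: continuous_subspaceT.
have /compact_bounded[C [_ HC]] := continuous_compact cphi' (@segment_compact R a b).
exists (`|C| + 1) => t; have [tab|/phi0->] := boolP (t \in `[a, b]); last first.
  by rewrite normr0 addr_ge0.
apply: HC; first by rewrite (le_lt_trans (ler_norm _))// ltrDl.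
by exists t.
Qed.

(* The substitution moves [x] from the singular kernel to the continuous factor. *)
Lemma abel_int_convolution e gam a b x phi : e = 1 \/ e = -1 -> gam < 1 -> a < b ->
  x \in `[a, b] -> continuous phi -> (forall t, t \notin `[a, b] -> phi t = 0) ->
  abel_int e gam a b phi x =
  \int[mu]_(s in `[- (b - a), b - a]) (abel_kernel gam s * phi (x - e * s)).
Proof.
move=> he g1 ab xab cphi phi0; have ba : 0 < b - a by rewrite subr_gt0.
have cs : continuous (fun s => phi (x - e * s)).
  move=> s; apply: (@continuous_comp _ _ _ (fun s => x - e * s) phi); last exact: cphi.
  apply: cvgB; first exact: cvg_cst.
  by apply: cvgM; [exact: cvg_cst|exact: cvg_id].
have mG : measurable_fun setT (fun s => abel_kernel gam s * phi (x - e * s)).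
  apply: measurable_funM; first exact: measurable_abel_kernel.
  exact: continuous_measurable_fun.
have mD : measurable (`[- (b - a), b - a]%classic : set R) by exact: measurable_itv.
have iG : mu.-integrable `[- (b - a), b - a]
    (EFin \o (fun s => abel_kernel gam s * phi (x - e * s))).
  have [C HC] := bounded_supported cphi phi0.
  apply: (integrable_mul_bounded (C := C) mD (integrable_abel_kernel g1 ba)).
    by apply: measurable_funTS; exact: continuous_measurable_fun.
  by move=> s _; exact: HC.
rewrite (Rintegral_oriented_dist x he mD mG iG) /abel_int.
rewrite [LHS]Rintegral_mkcond [RHS]Rintegral_mkcond; apply: eq_Rintegral => t _.
rewrite /patch; have := oriented_distK x he t => /= ->.
(* The preimage of [[- (b - a), b - a]] contains [[a, b]], and outside [[a, b]] the factor [phi]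
   vanishes. *)
case: ifPn => tab; case: ifPn => tD //.
- move: tD; rewrite notin_setE => /=; rewrite in_itv/= => -[].
  by apply: oriented_dist_itv => //; rewrite inE in tab.
- rewrite phi0 ?mulr0//; move: tab; rewrite notin_setE/= => /negP; exact.
Qed.

(** In the convolution form the singularity stays at [s = 0] while [x] moves, and the kernel times a
    bound of [phi] is an integrable majorant, so dominated convergence applies. *)
Lemma continuous_abel_int e gam a b phi : e = 1 \/ e = -1 -> gam < 1 -> a < b ->
  continuous phi -> (forall t, t \notin `[a, b] -> phi t = 0) ->
  {within `[a, b], continuous (abel_int e gam a b phi)}.
Proof.
move=> he g1 ab cphi phi0; have ba : 0 < b - a by rewrite subr_gt0.
pose G x := \int[mu]_(s in `[- (b - a), b - a]) (abel_kernel gam s * phi (x - e * s)).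
have mD : measurable (`[- (b - a), b - a]%classic : set R) by exact: measurable_itv.
have [C HC] := bounded_supported cphi phi0.
have cG : continuous G.
  move=> x.
  have cs y : continuous (fun s => phi (y - e * s)).
    move=> s; apply: (@continuous_comp _ _ _ (fun s => y - e * s) phi); last exact: cphi.
    apply: cvgB; first exact: cvg_cst.
    by apply: cvgM; [exact: cvg_cst|exact: cvg_id].
  have iG y : mu.-integrable `[- (b - a), b - a]
      (EFin \o (fun s => abel_kernel gam s * phi (y - e * s))).
    apply: (integrable_mul_bounded (C := C) mD (integrable_abel_kernel g1 ba)).
      by apply: measurable_funTS; exact: continuous_measurable_fun.
    by move=> s _; exact: HC.
  apply: (@continuity_under_integral R _ _ mu
    (fun y s => abel_kernel gam s * phi (y - e * s)) _ mD (x - 1) (x + 1)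
    (fun y _ => iG y) _ (fun s => abel_kernel gam s * C)).
  - apply: nearW => s _ y _; apply: cvgM; first exact: cvg_cst.
    apply: (@continuous_comp _ _ _ (fun y => y - e * s) phi); last exact: cphi.
    by apply: cvgB; [exact: cvg_id|exact: cvg_cst].
  - apply: (integrable_mul_bounded (C := `|C|) mD (integrable_abel_kernel g1 ba)) => //.
  - move=> y _; apply: nearW => s _.
    by rewrite normrM (ger0_norm (abel_kernel_ge0 _ _)) ler_wpM2l ?abel_kernel_ge0.
  - by rewrite inE/= in_itv/=; lra.
have : {within `[a, b], continuous G} by exact: continuous_subspaceT.
apply: subspace_eq_continuous => x; rewrite inE/= => xab.
exact: (esym (abel_int_convolution he g1 ab xab cphi phi0)).
Qed.

End AbelIntegral.

(** * Test functions and their effect on Abel integrals of derivatives *)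

Section TestFunctions.
Context {R : realType}.
Local Notation mu := (@lebesgue_measure R).
Implicit Types (a b gam e x t : R) (f y k : R -> R).

(** Differentiability is asked on the whole line, ends included; hence [derive1 k] is continuous and
    vanishes off [[a, b]], as the convolution form of the Abel integral requires. *)
Definition test_function a b k :=
  [/\ forall x, derivable k x 1, continuous (derive1 k) &
      forall x, x \notin `]a, b[ -> k x = 0].

Lemma derive1_lincomb k1 k2 (c1 c2 : R) x : derivable k1 x 1 -> derivable k2 x 1 ->
  derive1 (fun x => c1 * k1 x + c2 * k2 x) x = c1 * derive1 k1 x + c2 * derive1 k2 x.
Proof.
move=> d1 d2; have D (c : R) (k : R -> R) : derivable k x 1 -> derivable (fun x => c * k x) x 1.
  by move=> dk; apply: derivableM; [exact: derivable_cst|exact: dk].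
rewrite derive1E (deriveD (D c1 k1 d1) (D c2 k2 d2)) -!derive1E.
by rewrite (derive1Ml c1 d1) (derive1Ml c2 d2).
Qed.

Lemma test_functionD a b k1 k2 (c1 c2 : R) : test_function a b k1 -> test_function a b k2 ->
  test_function a b (fun x => c1 * k1 x + c2 * k2 x).
Proof.
move=> [d1 cd1 z1] [d2 cd2 z2]; split.
- move=> x; apply: derivableD; apply: derivableM => //; exact: derivable_cst.
- have -> : derive1 (fun x => c1 * k1 x + c2 * k2 x) =
      (fun x => c1 * derive1 k1 x + c2 * derive1 k2 x).
    by apply/funext => x; exact: derive1_lincomb.
  move=> x; apply: cvgD; apply: cvgM; [exact: cvg_cst|exact: cd1|exact: cvg_cst|exact: cd2].
- by move=> x xab; rewrite z1// z2// !mulr0 addr0.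
Qed.

Lemma test_function_continuous a b k : test_function a b k -> continuous k.
Proof.
move=> [dk _ _] x; apply: differentiable_continuous.
by rewrite -derivable1_diffP.
Qed.

Lemma test_function_ends a b k : test_function a b k -> k a = 0 /\ k b = 0.
Proof. by move=> [_ _ k0]; split; apply: k0; rewrite in_itv/= ltxx ?andbF. Qed.

Lemma test_function_derive1_out a b k : test_function a b k ->
  forall t, t \notin `[a, b] -> derive1 k t = 0.
Proof.
move=> [_ _ k0] t; rewrite in_itv/= negb_and -!ltNge => tab.
rewrite (@derive1_near _ k (cst 0)) ?derive1_cst//.
case/orP: tab => tab; near=> z; apply: k0; rewrite in_itv/= negb_and -!leNgt; apply/orP.
- by left; apply: ltW; near: z; exact: lt_nbhsl.
- by right; apply: ltW; near: z; exact: lt_nbhsr.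
Unshelve. all: by end_near. Qed.

Lemma test_function_lipschitz a b k : test_function a b k ->
  exists2 C, 0 < C & forall u v, `|k v - k u| <= C * `|v - u|.
Proof.
move=> tk; have [dk cdk _] := tk.
have [C HC] := bounded_supported cdk (test_function_derive1_out tk).
exists (`|C| + 1); first by rewrite ltr_wpDl.
suff H u v : u <= v -> `|k v - k u| <= (`|C| + 1) * `|v - u|.
  by move=> u v; have [/H//|/ltW/H] := leP u v; rewrite distrC (distrC u).
move=> uv; have [|c cuv ->] := @MVT_segment R k (derive1 k) u v uv _
  (continuous_subspaceT (test_function_continuous tk)).
  by move=> x _; rewrite derive1E; apply: DeriveDef.
rewrite normrM ler_wpM2r// (le_trans (HC c))// (le_trans (ler_norm _))//.
by rewrite lerDl.
Qed.

Lemma test_function_ac a b k : test_function a b k -> abs_continuous a b k.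
Proof.
move=> /test_function_lipschitz[C C0 kC] e e0; exists (e / C); first by rewrite divr_gt0.
move=> n u v uv _; rewrite ltr_pdivlMr// mulrC => lenC; apply: le_lt_trans lenC.
rewrite mulr_sumr; apply: ler_sum => i _; have [_ [uivi _]] := uv i.
by apply: le_trans (kC _ _) _; rewrite ger0_norm ?subr_ge0.
Qed.

Lemma abs_continuousD a b f y : abs_continuous a b f -> abs_continuous a b y ->
  abs_continuous a b (f \+ y).
Proof.
move=> acf acy e e0; have e20 : 0 < e / 2 by rewrite divr_gt0.
have [d1 d10 H1] := acf _ e20; have [d2 d20 H2] := acy _ e20.
exists (Num.min d1 d2) => [|n u v uv tI]; first by rewrite lt_min d10.
rewrite lt_min => /andP[len1 len2].
apply: (@le_lt_trans _ _ (\sum_(i < n) `|f (v i) - f (u i)| +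
  \sum_(i < n) `|y (v i) - y (u i)|)); last first.
  by rewrite (splitr e) ltrD ?H1 ?H2.
rewrite -big_split/=; apply: ler_sum => i _.
by rewrite opprD addrACA ler_normD.
Qed.

(** Measurability of [g] is a separate hypothesis since it does not follow from equality almost
    everywhere over the Borel sets. *)
Lemma ae_eq_integrable (D : set R) (g h : R -> \bar R) : measurable D ->
  measurable_fun D g -> ae_eq mu D g h -> mu.-integrable D h -> mu.-integrable D g.
Proof.
move=> mD mg gh /integrableP[mh hoo]; apply/integrableP; split => //.
rewrite (@ge0_ae_eq_integral _ _ _ mu D _ (fun x => `|h x|%E))//.
- exact: measurableT_comp.
- exact: measurableT_comp.
- move: gh; apply: filterS => // x + Dx; by move=> /(_ Dx) ->.
Qed.

Lemma ae_neq x : {ae mu, forall t, t != x}.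
Proof.
exists [set x]; split => //=; first exact: lebesgue_measure_set1.
by move=> t /= /negP; rewrite negbK => /eqP.
Qed.

Lemma ae_itvcc a b (P : R -> Prop) : {ae mu, forall t, t \in `]a, b[ -> P t} ->
  {ae mu, forall t, t \in `[a, b] -> P t}.
Proof.
have aeF : Filter (almost_everywhere mu) := ae_filter_ringOfSetsType mu.
move=> Pab; move: (filterI (Filter := aeF) Pab
  (filterI (Filter := aeF) (ae_neq a) (ae_neq b))).
apply: filterS => t [Pt [ta tb]]; rewrite in_itv/= => /andP[at_ tb'].
by apply: Pt; rewrite in_itv/= !lt_neqAle at_ tb' tb eq_sym ta.
Qed.

Definition abel_derive1_integrable e gam a b f x :=
  mu.-integrable `[a, b]
    (fun t => (abel_kernel gam (oriented_dist e x t) * derive1 f t)%:E).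

Lemma test_function_abel_integrable e gam a b k x : e = 1 \/ e = -1 -> gam < 1 -> a < b ->
  x \in `[a, b] -> test_function a b k -> abel_derive1_integrable e gam a b k x.
Proof.
move=> he g1 ab xab tk; have [dk cdk _] := tk; apply: integrable_abel => //.
  by apply: measurable_funTS; exact: continuous_measurable_fun.
have [C HC] := bounded_supported cdk (test_function_derive1_out tk).
by exists C => t _.
Qed.

(** The identity [(y + k)' = y' + k'] holds almost everywhere, which is enough for the integrals
    once the left-hand side is known to be measurable. *)
Lemma abel_derive1D e gam a b y k x : e = 1 \/ e = -1 -> gam < 1 -> a < b ->
  x \in `[a, b] -> abs_continuous a b y -> test_function a b k ->
  abel_derive1_integrable e gam a b y x ->
  abel_derive1_integrable e gam a b (y \+ k) x /\
  abel_int e gam a b (derive1 (y \+ k)) x =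
  abel_int e gam a b (derive1 y) x + abel_int e gam a b (derive1 k) x.
Proof.
move=> he g1 ab xab acy tk Iy; have [dk cdk _] := tk.
have Ik := test_function_abel_integrable he g1 ab xab tk.
pose ker t := abel_kernel gam (oriented_dist e x t).
have mD : measurable (`[a, b]%classic : set (measurableTypeR R)) by exact: measurable_itv.
have mg : measurable_fun `[a, b] (fun t => (ker t * derive1 (y \+ k) t)%:E).
  apply/measurable_EFinP; apply: measurable_funM.
    apply: measurable_funTS; apply: measurableT_comp.
      exact: measurable_abel_kernel.
    exact: measurable_oriented_dist.
  apply: measurable_derive1_itv => //; apply: abs_continuous_seq_ac.
  by apply: abs_continuousD => //; exact: test_function_ac.
have aeE : ae_eq mu `[a, b]%classic (fun t => (ker t * derive1 (y \+ k) t)%:E)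
    (fun t => (ker t * derive1 y t + ker t * derive1 k t)%:E).
  have := ae_itvcc (derive1D_ae ab (abs_continuous_seq_ac acy) dk).
  apply: filterS; first exact: (ae_filter_ringOfSetsType mu).
  by move=> t H tab; rewrite H// mulrDr.
have Is : mu.-integrable `[a, b]
    (fun t => (ker t * derive1 y t + ker t * derive1 k t)%:E).
  have := integrableD mD Iy Ik.
  by apply: eq_integrable => // t _; rewrite EFinD.
split; first exact: ae_eq_integrable aeE Is.
rewrite /abel_int -RintegralD//; congr fine; apply: ae_eq_integral => //.
by case/integrableP : Is.
Qed.

End TestFunctions.

(** * Stability of the function space under test functions *)

Section CaputoSpace.
Context {R : realType}.
Local Notation mu := (@lebesgue_measure R).
Implicit Types (a b gam alpha beta x t : R) (f y k z G : R -> R).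

(** An equality of extensions by zero serves both the values of the integrals and their existence.
    At [t = x] it rests on [powR] vanishing at base 0 for a nonzero exponent. *)
Lemma abel_left_patch gam a b f x : gam != 0 -> x \in `[a, b] ->
  (fun t => (x - t) `^ (- gam) * f t) \_ `[a, x] =
  (fun t => abel_kernel gam (oriented_dist 1 x t) * f t) \_ `[a, b].
Proof.
move=> g0; rewrite in_itv/= => /andP[ax xb]; apply/funext => t.
rewrite /patch /abel_kernel /oriented_dist mul1r subr_gt0.
have [tx|xt|->] := ltgtP t x.
- have -> : (t \in `[a, x]%classic) = (t \in `[a, b]%classic) => //.
  by apply/idP/idP; rewrite !inE/= !in_itv/=; lra.
- rewrite memNset /=; last by rewrite in_itv/=; lra.
  by case: ifP => //; rewrite mul0r.
- by rewrite subrr powR0 ?oppr_eq0// !mul0r; case: ifP; case: ifP.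
Qed.

Lemma abel_right_patch gam a b f x : gam != 0 -> x \in `[a, b] ->
  (fun t => (t - x) `^ (- gam) * f t) \_ `[x, b] =
  (fun t => abel_kernel gam (oriented_dist (-1) x t) * f t) \_ `[a, b].
Proof.
move=> g0; rewrite in_itv/= => /andP[ax xb]; apply/funext => t.
rewrite /patch /abel_kernel /oriented_dist mulN1r opprB subr_gt0.
have [tx|xt|->] := ltgtP t x.
- rewrite memNset /=; last by rewrite in_itv/=; lra.
  by case: ifP => //; rewrite mul0r.
- have -> : (t \in `[x, b]%classic) = (t \in `[a, b]%classic) => //.
  by apply/idP/idP; rewrite !inE/= !in_itv/=; lra.
- by rewrite subrr powR0 ?oppr_eq0// !mul0r; case: ifP; case: ifP.
Qed.

Lemma abel_leftE gam a b f x : gam != 0 -> x \in `[a, b] ->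
  abel_left gam a f x = abel_int 1 gam a b f x.
Proof.
by move=> g0 xab; rewrite /abel_left /abel_int Rintegral_mkcond (abel_left_patch _ g0 xab)
  -Rintegral_mkcond.
Qed.

Lemma abel_rightE gam a b f x : gam != 0 -> x \in `[a, b] ->
  abel_right gam b f x = abel_int (-1) gam a b f x.
Proof.
by move=> g0 xab; rewrite /abel_right /abel_int Rintegral_mkcond (abel_right_patch _ g0 xab)
  -Rintegral_mkcond.
Qed.

Lemma integrable_patch_eq (A B : set (measurableTypeR R)) (f1 f2 : R -> R) :
  measurable A -> measurable B ->
  f1 \_ A = f2 \_ B -> mu.-integrable A (EFin \o f1) = mu.-integrable B (EFin \o f2).
Proof.
move=> mA mB f12; apply/idP/idP => [/(integrable_mkcond _ mA).1|/(integrable_mkcond _ mB).1].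
  by rewrite restrict_EFin f12 -restrict_EFin => /(integrable_mkcond _ mB).2.
by rewrite restrict_EFin -f12 -restrict_EFin => /(integrable_mkcond _ mA).2.
Qed.

Lemma abel_left_existsE gam a b f x : gam != 0 -> x \in `[a, b] ->
  abel_left_exists gam a f x <->
  mu.-integrable `[a, b] (fun t => (abel_kernel gam (oriented_dist 1 x t) * f t)%:E).
Proof.
move=> g0 xab; rewrite /abel_left_exists.
by have -> := integrable_patch_eq (measurable_itv _) (measurable_itv _)
  (abel_left_patch f g0 xab).
Qed.

Lemma abel_right_existsE gam a b f x : gam != 0 -> x \in `[a, b] ->
  abel_right_exists gam b f x <->
  mu.-integrable `[a, b] (fun t => (abel_kernel gam (oriented_dist (-1) x t) * f t)%:E).
Proof.
move=> g0 xab; rewrite /abel_right_exists.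
by have -> := integrable_patch_eq (measurable_itv _) (measurable_itv _)
  (abel_right_patch f g0 xab).
Qed.

(** At [a] the Caputo derivative is a limit, whereas the integral itself would run over a single
    point; a continuous [G] that agrees on []a, b]] identifies this limit as [G a]. *)
Lemma caputo_left_ext alpha a b z G : a < b -> {within `[a, b], continuous G} ->
  (forall x, x \in `]a, b] -> caputo_left_int alpha a z x = G x) ->
  [/\ cvg (caputo_left_int alpha a z x @[x --> a^'+]),
      {within `[a, b], continuous (caputo_left alpha a z)} &
      forall x, x \in `[a, b] -> caputo_left alpha a z x = G x].
Proof.
move=> ab cG zG; have [_ Ga _] := (continuous_within_itvP _ ab).1 cG.
have za : caputo_left_int alpha a z x @[x --> a^'+] --> G a.
  apply: cvg_trans Ga; apply: near_eq_cvg; near=> x; apply/esym/zG.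
  rewrite in_itv/=; apply/andP; split; near: x; first exact: nbhs_right_gt.
  exact: nbhs_right_le.
have zE x : x \in `[a, b] -> caputo_left alpha a z x = G x.
  rewrite /caputo_left in_itv/= => /andP[ax xb]; case: eqP => [->|/eqP xa].
    exact/cvg_lim.
  by rewrite zG// in_itv/= xb andbT lt_neqAle eq_sym xa.
split => //; first by apply/cvg_ex; exists (G a).
by move: cG; apply: subspace_eq_continuous => x; rewrite inE => /zE.
Unshelve. all: by end_near. Qed.

Lemma caputo_right_ext beta a b z G : a < b -> {within `[a, b], continuous G} ->
  (forall x, x \in `[a, b[ -> caputo_right_int beta b z x = G x) ->
  [/\ cvg (caputo_right_int beta b z x @[x --> b^'-]),
      {within `[a, b], continuous (caputo_right beta b z)} &
      forall x, x \in `[a, b] -> caputo_right beta b z x = G x].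
Proof.
move=> ab cG zG; have [_ _ Gb] := (continuous_within_itvP _ ab).1 cG.
have zb : caputo_right_int beta b z x @[x --> b^'-] --> G b.
  apply: cvg_trans Gb; apply: near_eq_cvg; near=> x; apply/esym/zG.
  rewrite in_itv/=; apply/andP; split; near: x; last exact: nbhs_left_lt.
  exact: nbhs_left_ge.
have zE x : x \in `[a, b] -> caputo_right beta b z x = G x.
  rewrite /caputo_right in_itv/= => /andP[ax xb]; case: eqP => [->|/eqP xa].
    exact/cvg_lim.
  by rewrite zG// in_itv/= ax lt_neqAle xa.
split => //; first by apply/cvg_ex; exists (G b).
by move: cG; apply: subspace_eq_continuous => x; rewrite inE => /zE.
Unshelve. all: by end_near. Qed.

(** For a test function the integral formula is already continuous up to [a], so no limit is taken
    there. *)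
Definition test_caputo_left alpha a b k x : R :=
  (Gamma (1 - alpha))^-1 * abel_int 1 alpha a b (derive1 k) x.

Definition test_caputo_right beta a b k x : R :=
  - (Gamma (1 - beta))^-1 * abel_int (-1) beta a b (derive1 k) x.

Lemma continuous_test_caputo_left alpha a b k : alpha < 1 -> a < b ->
  test_function a b k -> {within `[a, b], continuous (test_caputo_left alpha a b k)}.
Proof.
move=> a1 ab tk; have [_ cdk _] := tk.
have := continuous_abel_int (or_introl erefl) a1 ab cdk (test_function_derive1_out tk).
by move=> H x; apply: cvgM; [exact: cvg_cst|exact: H].
Qed.

Lemma continuous_test_caputo_right beta a b k : beta < 1 -> a < b ->
  test_function a b k -> {within `[a, b], continuous (test_caputo_right beta a b k)}.
Proof.
move=> b1 ab tk; have [_ cdk _] := tk.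
have := continuous_abel_int (or_intror erefl) b1 ab cdk (test_function_derive1_out tk).
by move=> H x; apply: cvgM; [exact: cvg_cst|exact: H].
Qed.

(** On []a, b]] the sum formula comes from the Abel integrals. Its right-hand side is continuous on
    [[a, b]] and serves as [G] in [caputo_left_ext], which settles the point [a]. *)
Lemma caputo_leftD alpha a b y k : 0 < alpha < 1 -> a < b -> abs_continuous a b y ->
  has_continuous_caputo_left alpha a b y -> test_function a b k ->
  has_continuous_caputo_left alpha a b (y \+ k) /\
  forall x, x \in `[a, b] ->
    caputo_left alpha a (y \+ k) x = caputo_left alpha a y x + test_caputo_left alpha a b k x.
Proof.
move=> /andP[al0 al1] ab acy [ey cy ccy] tk.
have al : alpha != 0 by rewrite gt_eqF.
have he : (1 : R) = 1 \/ (1 : R) = -1 by left.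
have sub x : x \in `]a, b] -> x \in `[a, b] by rewrite !in_itv/=; lra.
have key x : x \in `]a, b] -> abel_left_exists alpha a (derive1 (y \+ k)) x /\
    caputo_left_int alpha a (y \+ k) x =
    caputo_left alpha a y x + test_caputo_left alpha a b k x.
  move=> xab; have xab' := sub _ xab.
  have [I E] := abel_derive1D he al1 ab xab' acy tk ((abel_left_existsE _ al xab').1 (ey x xab)).
  split; first exact/(abel_left_existsE _ al xab').
  have xa : x != a by move: xab; rewrite in_itv/= => /andP[/gt_eqF ->].
  rewrite /caputo_left (negbTE xa) /caputo_left_int /test_caputo_left.
  by rewrite !(abel_leftE _ al xab') E mulrDr.
have [|x xab|c1 c2 c3] := @caputo_left_ext alpha a b (y \+ k)
    (fun x => caputo_left alpha a y x + test_caputo_left alpha a b k x) ab.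
- by move=> x; apply: cvgD; [exact: ccy|exact: continuous_test_caputo_left].
- by have [] := key x xab.
by split => //; split => // x /key[].
Qed.

Lemma caputo_rightD beta a b y k : 0 < beta < 1 -> a < b -> abs_continuous a b y ->
  has_continuous_caputo_right beta a b y -> test_function a b k ->
  has_continuous_caputo_right beta a b (y \+ k) /\
  forall x, x \in `[a, b] ->
    caputo_right beta b (y \+ k) x = caputo_right beta b y x + test_caputo_right beta a b k x.
Proof.
move=> /andP[al0 al1] ab acy [ey cy ccy] tk.
have al : beta != 0 by rewrite gt_eqF.
have he : (-1 : R) = 1 \/ (-1 : R) = -1 by right.
have sub x : x \in `[a, b[ -> x \in `[a, b] by rewrite !in_itv/=; lra.
have key x : x \in `[a, b[ -> abel_right_exists beta b (derive1 (y \+ k)) x /\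
    caputo_right_int beta b (y \+ k) x =
    caputo_right beta b y x + test_caputo_right beta a b k x.
  move=> xab; have xab' := sub _ xab.
  have [I E] := abel_derive1D he al1 ab xab' acy tk ((abel_right_existsE _ al xab').1 (ey x xab)).
  split; first exact/(abel_right_existsE _ al xab').
  have xb : x != b by move: xab; rewrite in_itv/= => /andP[_ /lt_eqF ->].
  rewrite /caputo_right (negbTE xb) /caputo_right_int /test_caputo_right.
  by rewrite !(abel_rightE _ al xab') E mulrDr.
have [|x xab|c1 c2 c3] := @caputo_right_ext beta a b (y \+ k)
    (fun x => caputo_right beta b y x + test_caputo_right beta a b k x) ab.
- by move=> x; apply: cvgD; [exact: ccy|exact: continuous_test_caputo_right].
- by have [] := key x xab.
by split => //; split => // x /key[].
Qed.

Lemma caputo_spaceD alpha beta a b y k : 0 < alpha < 1 -> 0 < beta < 1 -> a < b ->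
  caputo_space alpha beta a b y -> test_function a b k ->
  caputo_space alpha beta a b (y \+ k).
Proof.
move=> al be ab [acy ly ry] tk; split.
- by apply: abs_continuousD => //; exact: test_function_ac.
- by have [] := caputo_leftD al ab acy ly tk.
- by have [] := caputo_rightD be ab acy ry tk.
Qed.

Lemma test_function_caputo_space alpha beta a b k : 0 < alpha < 1 -> 0 < beta < 1 -> a < b ->
  test_function a b k -> caputo_space alpha beta a b k.
Proof.
move=> /andP[al0 al1] /andP[be0 be1] ab tk.
have al : alpha != 0 by rewrite gt_eqF.
have be : beta != 0 by rewrite gt_eqF.
split; first exact: test_function_ac.
- have sub x : x \in `]a, b] -> x \in `[a, b] by rewrite !in_itv/=; lra.
  have [|x xab|c1 c2 _] := @caputo_left_ext alpha a b k (test_caputo_left alpha a b k) ab.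
  + exact: continuous_test_caputo_left.
  + by rewrite /caputo_left_int (abel_leftE _ al (sub x xab)).
  split => // x /sub xab; apply/(abel_left_existsE _ al xab).
  by apply: test_function_abel_integrable => //; left.
- have sub x : x \in `[a, b[ -> x \in `[a, b] by rewrite !in_itv/=; lra.
  have [|x xab|c1 c2 _] := @caputo_right_ext beta a b k (test_caputo_right beta a b k) ab.
  + exact: continuous_test_caputo_right.
  + by rewrite /caputo_right_int (abel_rightE _ be (sub x xab)).
  split => // x /sub xab; apply/(abel_right_existsE _ be xab).
  by apply: test_function_abel_integrable => //; right.
Qed.

End CaputoSpace.

(** * Continuity on the slab and mean value estimates *)

Section Slab.
Context {R : realType}.
Implicit Types (a b e d x y u v : R) (f : R -> R) (G : R -> R -> R -> R -> R).

Lemma within_itv_epsP a b f : {within `[a, b], continuous f} <->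
  forall x0, x0 \in `[a, b] -> forall e, 0 < e -> exists2 d, 0 < d &
    forall x, x \in `[a, b] -> `|x - x0| < d -> `|f x - f x0| < e.
Proof.
rewrite subspace_continuousP; split => H x0 x0ab.
- move=> e e0; have /cvgrPdist_lt/(_ e e0) := H x0 x0ab.
  rewrite near_withinE => /nbhs_ballP[d /= d0 Hd]; exists d => // x xab xd.
  by rewrite distrC; apply: (Hd x) => //; rewrite /ball/= distrC.
- apply/cvgrPdist_lt => e e0; have [d d0 Hd] := H x0 x0ab e e0.
  rewrite near_withinE; apply/nbhs_ballP; exists d => //= x xd xab.
  by rewrite distrC; apply: Hd => //; rewrite distrC.
Qed.

Definition slab_continuous a b G := forall x0 y0 u0 v0, x0 \in `[a, b] ->
  forall e, 0 < e -> exists2 d, 0 < d & forall x y u v, x \in `[a, b] ->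
    `|x - x0| < d -> `|y - y0| < d -> `|u - u0| < d -> `|v - v0| < d ->
    `|G x y u v - G x0 y0 u0 v0| < e.

Lemma continuous_on_slab_eps a b G : continuous_on_slab a b G -> slab_continuous a b G.
Proof.
move=> /subspace_continuousP H x0 y0 u0 v0 x0ab e e0.
have /cvgrPdist_lt/(_ e e0) := H (x0, y0, u0, v0) x0ab.
rewrite near_withinE => /nbhs_ballP[d /= d0 Hd]; exists d => // x y u v xab xd yd ud vd.
rewrite distrC; apply: (Hd (x, y, u, v)) => //.
by split; [split; [split|]|]; rewrite /ball/= distrC.
Qed.

(** Compactness of [[a, b]] makes the radius [d] of the tube around the curve independent of [x]. *)
Lemma slab_continuous_tube a b G (c1 c2 c3 : R -> R) : slab_continuous a b G ->
  {within `[a, b], continuous c1} -> {within `[a, b], continuous c2} ->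
  {within `[a, b], continuous c3} ->
  forall e, 0 < e -> exists2 d, 0 < d & forall x y u v, x \in `[a, b] ->
    `|y - c1 x| < d -> `|u - c2 x| < d -> `|v - c3 x| < d ->
    `|G x y u v - G x (c1 x) (c2 x) (c3 x)| < e.
Proof.
move=> sG /within_itv_epsP cc1 /within_itv_epsP cc2 /within_itv_epsP cc3 e e0.
pose P d x := x \in `[a, b] -> forall y u v,
    `|y - c1 x| < d -> `|u - c2 x| < d -> `|v - c3 x| < d ->
    `|G x y u v - G x (c1 x) (c2 x) (c3 x)| < e.
(* The covering form of compactness, with the radius of the tube tending to 0 from the right: it
   suffices to treat [x] near a fixed [x0], where both values of [G] are compared with the one at
   [x0]. *)
have /compact_near_coveringP/(_ _ (0^'+) P) := @segment_compact R a b.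
have pf : Filter (0^'+ : set_system R) by exact: at_right_proper_filter.
move=> /(_ pf)[] => [x0 x0ab|d /= d0 H]; last first.
  exists (d / 2); first by rewrite divr_gt0.
  move=> x y u v xab; apply: (H (d / 2)) => //=; last by rewrite divr_gt0.
  by rewrite sub0r normrN gtr0_norm ?divr_gt0// ltr_pdivrMr// ltr_pMr// ltr1n.
have e20 : 0 < e / 2 by rewrite divr_gt0.
have [d d0 Hd] := sG x0 (c1 x0) (c2 x0) (c3 x0) x0ab _ e20.
have d20 : 0 < d / 2 by rewrite divr_gt0.
have [r1 r10 H1] := cc1 x0 x0ab _ d20.
have [r2 r20 H2] := cc2 x0 x0ab _ d20.
have [r3 r30 H3] := cc3 x0 x0ab _ d20.
near=> x i; rewrite /P => xab y u v yi ui vi.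
have id2 : i < d / 2 by near: i; exact: nbhs_right_lt.
have xd : `|x - x0| < d by near: x; apply: cvgr_distC_lt => //; exact: cvg_id.
have x1 : `|x - x0| < r1 by near: x; apply: cvgr_distC_lt => //; exact: cvg_id.
have x2 : `|x - x0| < r2 by near: x; apply: cvgr_distC_lt => //; exact: cvg_id.
have x3 : `|x - x0| < r3 by near: x; apply: cvgr_distC_lt => //; exact: cvg_id.
have K1 := H1 x xab x1; have K2 := H2 x xab x2; have K3 := H3 x xab x3.
have tri (p q r : R) : `|p - q| < i -> `|q - r| < d / 2 -> `|p - r| < d.
  move=> pq qr; have -> : p - r = (p - q) + (q - r) by ring.
  apply: le_lt_trans (ler_normD _ _) _; rewrite (splitr d) ltrD//.
  exact: lt_trans id2.
have lt2 (p : R) : p < d / 2 -> p < d.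
  by move=> /lt_trans; apply; rewrite ltr_pdivrMr// ltr_pMr// ltr1n.
have A1 := Hd x y u v xab xd (tri _ _ _ yi K1) (tri _ _ _ ui K2) (tri _ _ _ vi K3).
have A2 := Hd x (c1 x) (c2 x) (c3 x) xab xd (lt2 _ K1) (lt2 _ K2) (lt2 _ K3).
rewrite distrC in A2.
set p := G x y u v in A1 *; set q := G x _ _ _ in A2 *.
set r := G x0 _ _ _ in A1 A2.
have -> : p - q = (p - r) + (r - q) by ring.
by apply: le_lt_trans (ler_normD _ _) _; rewrite (splitr e) ltrD.
Unshelve. all: by end_near. Qed.

Lemma slab_continuous_along a b G (c1 c2 c3 : R -> R) : slab_continuous a b G ->
  {within `[a, b], continuous c1} -> {within `[a, b], continuous c2} ->
  {within `[a, b], continuous c3} ->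
  {within `[a, b], continuous (fun x => G x (c1 x) (c2 x) (c3 x))}.
Proof.
move=> sG /within_itv_epsP cc1 /within_itv_epsP cc2 /within_itv_epsP cc3.
apply/within_itv_epsP => x0 x0ab e e0.
have [d d0 Hd] := sG x0 (c1 x0) (c2 x0) (c3 x0) x0ab _ e0.
have [r1 r10 H1] := cc1 x0 x0ab _ d0.
have [r2 r20 H2] := cc2 x0 x0ab _ d0.
have [r3 r30 H3] := cc3 x0 x0ab _ d0.
exists (Num.min (Num.min d r1) (Num.min r2 r3)); first by rewrite !lt_min d0 r10 r20.
move=> x xab; rewrite !lt_min => /andP[/andP[xd x1] /andP[x2 x3]].
by apply: Hd => //; [exact: H1|exact: H2|exact: H3].
Qed.

Lemma diff_quot_onP a b f x (l : R) : (diff_quot_on a b f x --> l) <->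
  forall e, 0 < e -> exists2 d, 0 < d & forall z, z \in `[a, b] -> z != x ->
    `|z - x| < d -> `|l - (f z - f x) / (z - x)| < e.
Proof.
rewrite /diff_quot_on; split=> [/cvgrPdist_lt H e e0|H].
- have /= := H e e0; rewrite /dnbhs /within/= => /nbhs_ballP[d /= d0 Hd].
  by exists d => // z zab zx zd; apply: Hd => //; rewrite /ball/= distrC.
- apply/cvgrPdist_lt => e e0; have [d d0 Hd] := H e e0.
  rewrite /dnbhs /within/=; apply/nbhs_ballP; exists d => //= z zd zx zab.
  by apply: Hd => //; rewrite distrC.
Qed.

Lemma derive_on_interior a b f x : x \in `]a, b[ -> derivable_on a b f x ->
  is_derive x 1 f (derive_on a b f x).
Proof.
rewrite in_itv/= => /andP[ax xb] /diff_quot_onP H.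
have cq : diff_quot f h x @[h --> 0^'] --> derive_on a b f x.
  apply/cvgrPdist_lt => e e0; have [d d0 Hd] := H e e0.
  apply/dnbhs0P; exists (Num.min d (Num.min (x - a) (b - x))).
    by rewrite !lt_min d0 !subr_gt0 ax.
  move=> h h0; rewrite !lt_min => /and3P[hd hax hbx].
  move: hax hbx; rewrite !(ltr_norml h) => /andP[h3 h4] /andP[h5 h6].
  have -> : diff_quot f h x = (f (h + x) - f x) / (h + x - x).
    by rewrite /diff_quot addrK mulrC.
  apply: Hd; first by rewrite in_itv/=; lra.
  - by rewrite -subr_eq0 addrK.
  - by rewrite addrK.
have dfx : derivable f x 1 by rewrite derivable_diff_quot; apply/cvg_ex; eexists; exact: cq.
apply: DeriveDef => //; rewrite -derive1E; exact: cvg_lim cq.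
Qed.

Lemma derivable_on_continuous a b f :
  (forall x, x \in `[a, b] -> derivable_on a b f x) -> {within `[a, b], continuous f}.
Proof.
move=> df; apply/within_itv_epsP => x xab e e0.
have /diff_quot_onP/(_ 1 ltr01)[d d0 Hd] := df x xab.
set l := lim _ in Hd.
have l0 : 0 < `|l| + 1 by rewrite ltr_wpDl.
exists (Num.min d (e / (`|l| + 1))); first by rewrite lt_min d0 divr_gt0.
move=> z zab; rewrite lt_min ltr_pdivlMr// => /andP[zd ze].
have [->|zx] := eqVneq z x; first by rewrite subrr normr0.
have zx0 : z - x != 0 by rewrite subr_eq0.
have := Hd z zab zx zd; set q := _ / _ => Hq.
have -> : f z - f x = q * (z - x) by rewrite /q divfK.
rewrite normrM mulrC; apply: le_lt_trans ze; rewrite ler_wpM2l//.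
have -> : q = l - (l - q) by ring.
by apply: le_trans (ler_normB _ _) _; rewrite lerD2l ltW.
Qed.

Lemma derivable_on_lipschitz a b f u v M :
  (forall x, x \in `[a, b] -> derivable_on a b f x) ->
  a <= u -> u <= v -> v <= b ->
  (forall z, z \in `[u, v] -> `|derive_on a b f z| <= M) ->
  `|f v - f u| <= M * (v - u).
Proof.
move=> df au uv vb dM.
have [|//|c cuv ->] := @MVT_segment R f (derive_on a b f) u v uv.
- move=> z; rewrite in_itv/= => zuv; apply: derive_on_interior; first by rewrite in_itv/=; lra.
  by apply: df; rewrite in_itv/=; lra.
- apply: continuous_subspaceW (derivable_on_continuous df).
  by move=> z /=; rewrite !in_itv/=; lra.
by rewrite normrM (ger0_norm (_ : 0 <= v - u)) ?subr_ge0// ler_wpM2r ?subr_ge0// dM.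
Qed.

(** By the mean value theorem the error is [(derive1 f c - D) * p] for some [c] between [x] and
    [x + p]; with [D = 0] the estimate is a Lipschitz bound. *)
Lemma derivable_mvt_error f (D e x p : R) : (forall z, derivable f z 1) ->
  (forall z, `|z - x| <= `|p| -> `|derive1 f z - D| <= e) ->
  `|f (x + p) - f x - D * p| <= e * `|p|.
Proof.
move=> df De.
have cf : continuous f.
  by move=> z; apply: differentiable_continuous; rewrite -derivable1_diffP.
have dd (z : R) : is_derive z (1 : R) f (derive1 f z) by rewrite derive1E; exact: DeriveDef.
have [p0|/ltW p0] := leP 0 p.
- have xp : x <= x + p by rewrite lerDl.
  have [c cx ->] := MVT_segment xp (fun z _ => dd z) (continuous_subspaceT cf).
  rewrite (_ : _ - _ = (derive1 f c - D) * p); last by ring.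
  rewrite normrM ler_wpM2r// De//; move: cx; rewrite in_itv/= (ger0_norm p0) ler_norml.
  by move=> /andP[? ?]; apply/andP; split; lra.
- have xp : x + p <= x by rewrite gerDl.
  have [c cx E] := MVT_segment xp (fun z _ => dd z) (continuous_subspaceT cf).
  rewrite (_ : _ - _ = (derive1 f c - D) * p); last first.
    by rewrite -(opprB (f x)) E; ring.
  rewrite normrM ler_wpM2r// De//; move: cx; rewrite in_itv/= (ler0_norm p0) ler_norml.
  by move=> /andP[? ?]; apply/andP; split; lra.
Qed.

Lemma derivable_mvt_bound f (M x y : R) : (forall z, derivable f z 1) ->
  (forall z, `|z - x| <= `|y - x| -> `|derive1 f z| <= M) ->
  `|f y - f x| <= M * `|y - x|.
Proof.
move=> df fM; have := @derivable_mvt_error f 0 M x (y - x) df.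
rewrite mul0r subr0 (_ : x + (y - x) = y); last by ring.
apply=> z /fM.
by rewrite subr0.
Qed.

End Slab.

(** * Joint continuity and uniform linearization of a [C^1] integrand *)

Section FirstVariation.
Context {R : realType}.
Implicit Types (a b e d x : R).
Implicit Types (F : R -> R -> R -> R -> R).

Lemma sum_quarters_lt (M p q r w e : R) :
  p * (4 * M) < e -> q * (4 * M) < e -> r * (4 * M) < e -> w * (4 * M) < e ->
  M * p + M * q + M * r + M * w < e.
Proof. by move=> *; lra. Qed.

Lemma common_bound (p q r w : R) : 0 <= p -> 0 <= q -> 0 <= r -> 0 <= w ->
  exists2 M, 0 < M & [/\ 1 + p <= M, 1 + q <= M, 1 + r <= M & 1 + w <= M].
Proof. by move=> *; exists (1 + p + q + r + w); [lra|split; lra]. Qed.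

(** Class [C^1] is given through partial derivatives only. These are bounded near a point, so
    changing one variable at a time bounds each increment by the mean value theorem, with one-sided
    derivatives in [x]. *)
Lemma class_C1_slab_continuous a b F : class_C1 a b F -> slab_continuous a b F.
Proof.
move=> [dF [/continuous_on_slab_eps s1 /continuous_on_slab_eps s2
  /continuous_on_slab_eps s3 /continuous_on_slab_eps s4]] x0 y0 u0 v0 x0ab e e0.
have [d1 d10 H1] := s1 x0 y0 u0 v0 x0ab 1 ltr01.
have [d2 d20 H2] := s2 x0 y0 u0 v0 x0ab 1 ltr01.
have [d3 d30 H3] := s3 x0 y0 u0 v0 x0ab 1 ltr01.
have [d4 d40 H4] := s4 x0 y0 u0 v0 x0ab 1 ltr01.
have [M M0 [M1 M2 M3 M4]] := common_bound
  (normr_ge0 (partial1 a b F x0 y0 u0 v0)) (normr_ge0 (partial2 F x0 y0 u0 v0))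
  (normr_ge0 (partial3 F x0 y0 u0 v0)) (normr_ge0 (partial4 F x0 y0 u0 v0)).
have MB (p q : R) : `|p - q| < 1 -> 1 + `|q| <= M -> `|p| <= M.
  move=> pq; apply: le_trans; have -> : p = (p - q) + q by rewrite subrK.
  by apply: le_trans (ler_normD _ _) _; rewrite lerD2r ltW.
have [d d0 dd] : exists2 d, 0 < d &
    forall p, p < d -> [/\ p < d1, p < d2, p < d3 & p < d4].
  exists (Num.min (Num.min d1 d2) (Num.min d3 d4)) => [|p].
    by rewrite !lt_min d10 d20 d30 d40.
  by rewrite !lt_min => /andP[/andP[-> ->] /andP[-> ->]].
(* Each of the four increments, one per variable, then contributes less than [e / 4]. *)
exists (Num.min d (e / (4 * M))); first by rewrite lt_min d0 divr_gt0// mulr_gt0.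
move=> x y u v xab; rewrite !lt_min !ltr_pdivlMr ?mulr_gt0//.
move=> /andP[/dd[xd1 xd2 xd3 xd4] xe] /andP[/dd[yd1 yd2 yd3 yd4] ye].
move=> /andP[/dd[ud1 ud2 ud3 ud4] ue] /andP[/dd[vd1 vd2 vd3 vd4] ve].
have z1 : `|x0 - x0| < d1 by rewrite subrr normr0.
have z2 : `|x0 - x0| < d2 by rewrite subrr normr0.
have z3 : `|x0 - x0| < d3 by rewrite subrr normr0.
have z4 : `|x0 - x0| < d4 by rewrite subrr normr0.
have y3 : `|y0 - y0| < d3 by rewrite subrr normr0.
have y4 : `|y0 - y0| < d4 by rewrite subrr normr0.
have u4 : `|u0 - u0| < d4 by rewrite subrr normr0.
have E1 : `|F x y u v - F x0 y u v| <= M * `|x - x0|.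
  have dx z : z \in `[a, b] -> derivable_on a b (fun z => F z y u v) z.
    by move=> zab; have [] := dF z y u v zab.
  have bd z : z \in `[a, b] -> `|z - x0| < d1 -> `|derive_on a b (fun z => F z y u v) z| <= M.
    move=> zab zd; apply: (MB _ (partial1 a b F x0 y0 u0 v0)); last exact: M1.
    exact: H1.
  move: x0ab xab; rewrite !in_itv/= => /andP[ax0 x0b] /andP[ax xb].
  have [x0x|/ltW xx0] := leP x0 x.
  - rewrite (ger0_norm (_ : 0 <= x - x0)) ?subr_ge0//.
    apply: (@derivable_on_lipschitz _ a b (fun z => F z y u v)) => // z.
    rewrite in_itv/= => /andP[zx0 zx]; apply: bd; first by rewrite in_itv/=; clear -ax0 x0b ax xb zx0 zx; lra.
    by apply: le_lt_trans xd1; rewrite !ger0_norm ?subr_ge0 ?lerB// (le_trans zx0).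
  - rewrite distrC (distrC x) (ger0_norm (_ : 0 <= x0 - x)) ?subr_ge0//.
    apply: (@derivable_on_lipschitz _ a b (fun z => F z y u v)) => // z.
    rewrite in_itv/= => /andP[zx0 zx]; apply: bd; first by rewrite in_itv/=; clear -ax0 x0b ax xb zx0 zx; lra.
    by apply: le_lt_trans xd1; rewrite !ler0_norm ?subr_le0//; clear -zx0 zx; lra.
have E2 : `|F x0 y u v - F x0 y0 u v| <= M * `|y - y0|.
  apply: (@derivable_mvt_bound _ (fun z => F x0 z u v)) => z.
    by have [_ h _ _] := dF x0 z u v x0ab; exact: h.
  move=> zy; apply: (MB _ (partial2 F x0 y0 u0 v0)); last exact: M2.
  by apply: (H2 x0 z u v) => //; exact: le_lt_trans yd2.
have E3 : `|F x0 y0 u v - F x0 y0 u0 v| <= M * `|u - u0|.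
  apply: (@derivable_mvt_bound _ (fun z => F x0 y0 z v)) => z.
    by have [_ _ h _] := dF x0 y0 z v x0ab; exact: h.
  move=> zy; apply: (MB _ (partial3 F x0 y0 u0 v0)); last exact: M3.
  by apply: (H3 x0 y0 z v) => //; exact: le_lt_trans ud3.
have E4 : `|F x0 y0 u0 v - F x0 y0 u0 v0| <= M * `|v - v0|.
  apply: (@derivable_mvt_bound _ (fun z => F x0 y0 u0 z)) => z.
    by have [_ _ _ h] := dF x0 y0 u0 z x0ab; exact: h.
  move=> zy; apply: (MB _ (partial4 F x0 y0 u0 v0)); last exact: M4.
  by apply: (H4 x0 y0 u0 z) => //; exact: le_lt_trans vd4.
have -> : F x y u v - F x0 y0 u0 v0 = (F x y u v - F x0 y u v) +
  (F x0 y u v - F x0 y0 u v) + (F x0 y0 u v - F x0 y0 u0 v) +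
  (F x0 y0 u0 v - F x0 y0 u0 v0) by ring.
apply: le_lt_trans (ler_normD _ _) _.
apply: (@le_lt_trans _ _ (M * `|x - x0| + M * `|y - y0| + M * `|u - u0| + M * `|v - v0|)).
  rewrite lerD//; apply: le_trans (ler_normD _ _) _; rewrite lerD//.
  by apply: le_trans (ler_normD _ _) _; rewrite lerD.
exact: sum_quarters_lt.
Qed.

(** The three arguments change one after the other. Each partial derivative is evaluated inside the
    tube around the curve, hence within [e] of its value on the curve, uniformly in [x]. *)
Lemma class_C1_frechet a b F (c1 c2 c3 : R -> R) : class_C1 a b F ->
  {within `[a, b], continuous c1} -> {within `[a, b], continuous c2} ->
  {within `[a, b], continuous c3} ->
  forall e, 0 < e -> exists2 d, 0 < d & forall x (p q r : R), x \in `[a, b] ->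
    `|p| < d -> `|q| < d -> `|r| < d ->
    `|F x (c1 x + p) (c2 x + q) (c3 x + r) - F x (c1 x) (c2 x) (c3 x) -
      (partial2 F x (c1 x) (c2 x) (c3 x) * p + partial3 F x (c1 x) (c2 x) (c3 x) * q +
       partial4 F x (c1 x) (c2 x) (c3 x) * r)| <= e * (`|p| + `|q| + `|r|).
Proof.
move=> [dF [_ /continuous_on_slab_eps s2 /continuous_on_slab_eps s3
  /continuous_on_slab_eps s4]] cc1 cc2 cc3 e e0.
have [d2 d20 H2] := slab_continuous_tube s2 cc1 cc2 cc3 e0.
have [d3 d30 H3] := slab_continuous_tube s3 cc1 cc2 cc3 e0.
have [d4 d40 H4] := slab_continuous_tube s4 cc1 cc2 cc3 e0.
exists (Num.min d2 (Num.min d3 d4)); first by rewrite !lt_min d20 d30.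
move=> x p q r xab; rewrite !lt_min => /and3P[p2 p3 p4] /and3P[q2 q3 q4] /and3P[r2 r3 r4].
have K (c z : R) : `|c + z - c| = `|z| by congr `|_|; ring.
have Z (c w : R) : 0 < w -> `|c - c| < w by rewrite subrr normr0.
have T1 : `|F x (c1 x + p) (c2 x + q) (c3 x + r) - F x (c1 x) (c2 x + q) (c3 x + r) -
    partial2 F x (c1 x) (c2 x) (c3 x) * p| <= e * `|p|.
  apply: (@derivable_mvt_error _ (fun z => F x z (c2 x + q) (c3 x + r))) => z.
    by have [_ h _ _] := dF x z (c2 x + q) (c3 x + r) xab; exact: h.
  move=> zp; apply: ltW; apply: H2 => //; rewrite ?K//; exact: le_lt_trans zp p2.
have T2 : `|F x (c1 x) (c2 x + q) (c3 x + r) - F x (c1 x) (c2 x) (c3 x + r) -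
    partial3 F x (c1 x) (c2 x) (c3 x) * q| <= e * `|q|.
  apply: (@derivable_mvt_error _ (fun z => F x (c1 x) z (c3 x + r))) => z.
    by have [_ _ h _] := dF x (c1 x) z (c3 x + r) xab; exact: h.
  move=> zp; apply: ltW; apply: H3 => //; rewrite ?K ?Z//; exact: le_lt_trans zp q3.
have T3 : `|F x (c1 x) (c2 x) (c3 x + r) - F x (c1 x) (c2 x) (c3 x) -
    partial4 F x (c1 x) (c2 x) (c3 x) * r| <= e * `|r|.
  apply: (@derivable_mvt_error _ (fun z => F x (c1 x) (c2 x) z)) => z.
    by have [_ _ _ h] := dF x (c1 x) (c2 x) z xab; exact: h.
  move=> zp; apply: ltW; apply: H4 => //; rewrite ?Z//; exact: le_lt_trans zp r4.
set A := _ - _ - _ in T1; set B := _ - _ - _ in T2; set C := _ - _ - _ in T3.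
rewrite [X in `|X| <= _](_ : _ = A + B + C); last by rewrite /A /B /C; ring.
apply: le_trans (ler_normD _ _) _; rewrite mulrDr lerD//.
by apply: le_trans (ler_normD _ _) _; rewrite mulrDr lerD.
Qed.

End FirstVariation.

(** * Differentiability of the functionals along two test functions *)

Section FunctionalVariation.
Context {R : realType}.
Local Notation mu := (@lebesgue_measure R).
Implicit Types (a b gam alpha beta e d x s t : R) (f y k : R -> R).
Implicit Types (F G : R -> R -> R -> R -> R).

Lemma abs_continuous_within a b y : a <= b -> abs_continuous a b y ->
  {within `[a, b], continuous y}.
Proof.
move=> ab /abs_continuous_seq_ac acy.
have : {within `[a, b], continuous (y \o clamp a b)}.
  by apply: continuous_subspaceT; exact: seq_ac_clamp_continuous.
apply: subspace_eq_continuous => x; rewrite inE/= in_itv/= => xab.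
exact: (congr1 y (clamp_id xab)).
Qed.

Lemma within_continuous_integrable a b f : {within `[a, b], continuous f} ->
  mu.-integrable `[a, b] (EFin \o f).
Proof. by move=> cf; apply: continuous_compact_integrable => //; exact: segment_compact. Qed.

Lemma within_continuous_bounded a b f : {within `[a, b], continuous f} ->
  exists2 M, 0 < M & forall x, x \in `[a, b] -> `|f x| <= M.
Proof.
move=> cf; have /compact_bounded[C [_ HC]] := continuous_compact cf (@segment_compact R a b).
exists (`|C| + 1) => [|x xab]; first by rewrite ltr_wpDl.
by apply: HC; [rewrite (le_lt_trans (ler_norm _))// ltrDl|exists x].
Qed.

Lemma within_continuousM a b f y : {within `[a, b], continuous f} ->
  {within `[a, b], continuous y} -> {within `[a, b], continuous (fun x => f x * y x)}.
Proof. by move=> cf cy x; apply: cvgM; [exact: cf|exact: cy]. Qed.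

Lemma within_continuous_add a b f y : {within `[a, b], continuous f} ->
  {within `[a, b], continuous y} -> {within `[a, b], continuous (fun x => f x + y x)}.
Proof. by move=> cf cy x; apply: cvgD; [exact: cf|exact: cy]. Qed.

Lemma within_continuous_cst a b (c : R) : {within `[a, b], continuous (fun=> c : R)}.
Proof. by move=> x; exact: cvg_cst. Qed.

Lemma Rintegral_lincomb_integrable (D : set (measurableTypeR R)) (f1 f2 f : R -> R) s t :
  measurable D -> mu.-integrable D (EFin \o f1) -> mu.-integrable D (EFin \o f2) ->
  (forall z, D z -> f z = s * f1 z + t * f2 z) ->
  \int[mu]_(z in D) f z = s * \int[mu]_(z in D) f1 z + t * \int[mu]_(z in D) f2 z.
Proof.
move=> mD I1 I2 fE; rewrite -(RintegralZl s mD I1) -(RintegralZl t mD I2).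
rewrite -(RintegralD mD (integrableZl mD s I1) (integrableZl mD t I2)).
by apply: eq_Rintegral => z; rewrite inE => /fE.
Qed.

Lemma Rintegral_lincomb a b f y s t : {within `[a, b], continuous f} ->
  {within `[a, b], continuous y} ->
  \int[mu]_(x in `[a, b]) (s * f x + t * y x) =
  s * \int[mu]_(x in `[a, b]) f x + t * \int[mu]_(x in `[a, b]) y x.
Proof.
move=> cf cy; apply: Rintegral_lincomb_integrable => //.
- exact: within_continuous_integrable.
- exact: within_continuous_integrable.
Qed.

Lemma scale_lincomb (c s t p q : R) : c * (s * p + t * q) = s * (c * p) + t * (c * q).
Proof. by ring. Qed.

Lemma abel_int_lincomb e gam a b f y s t x : e = 1 \/ e = -1 -> gam < 1 -> a < b ->
  x \in `[a, b] -> {within `[a, b], continuous f} -> {within `[a, b], continuous y} ->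
  abel_int e gam a b (fun t' => s * f t' + t * y t') x =
  s * abel_int e gam a b f x + t * abel_int e gam a b y x.
Proof.
move=> he g1 ab xab cf cy.
have mD : measurable (`[a, b]%classic : set (measurableTypeR R)) by exact: measurable_itv.
have I h : {within `[a, b], continuous h} -> mu.-integrable `[a, b]
    (fun t => (abel_kernel gam (oriented_dist e x t) * h t)%:E).
  move=> ch; apply: integrable_abel => //.
    by apply/measurable_EFinP; exact: measurable_int (within_continuous_integrable ch).
  by have [M _ HM] := within_continuous_bounded ch; exists M.
apply: (Rintegral_lincomb_integrable mD (I _ cf) (I _ cy)) => z _.
exact: scale_lincomb.
Qed.

Lemma density_lincomb (c1 c2 c3 s t p1 p2 p3 q1 q2 q3 : R) :
  c1 * (s * p1 + t * q1) + c2 * (s * p2 + t * q2) + c3 * (s * p3 + t * q3) =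
  s * (c1 * p1 + c2 * p2 + c3 * p3) + t * (c1 * q1 + c2 * q2 + c3 * q3).
Proof. by ring. Qed.

Lemma le_sum3 (p q r M1 M2 M3 : R) : 0 < M1 -> 0 < M2 -> 0 < M3 ->
  p <= M1 -> q <= M2 -> r <= M3 ->
  [/\ p <= M1 + M2 + M3, q <= M1 + M2 + M3 & r <= M1 + M2 + M3].
Proof. by move=> *; split; lra. Qed.

Lemma sum3_le (p q r M : R) : p <= M -> q <= M -> r <= M -> p + q + r <= 3 * M.
Proof. by move=> *; lra. Qed.

Lemma test_caputo_left_lincomb alpha a b k1 k2 s t x : alpha < 1 -> a < b ->
  x \in `[a, b] -> test_function a b k1 -> test_function a b k2 ->
  test_caputo_left alpha a b (fun x => s * k1 x + t * k2 x) x =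
  s * test_caputo_left alpha a b k1 x + t * test_caputo_left alpha a b k2 x.
Proof.
move=> al1 ab xab [d1 cd1 _] [d2 cd2 _]; rewrite /test_caputo_left.
have -> : derive1 (fun x => s * k1 x + t * k2 x) =
    (fun x => s * derive1 k1 x + t * derive1 k2 x).
  by apply/funext => z; exact: derive1_lincomb.
have c1 : {within `[a, b], continuous (derive1 k1)} by exact: continuous_subspaceT.
have c2 : {within `[a, b], continuous (derive1 k2)} by exact: continuous_subspaceT.
rewrite (abel_int_lincomb s t (or_introl erefl) al1 ab xab c1 c2).
exact: scale_lincomb.
Qed.

Lemma test_caputo_right_lincomb beta a b k1 k2 s t x : beta < 1 -> a < b ->
  x \in `[a, b] -> test_function a b k1 -> test_function a b k2 ->
  test_caputo_right beta a b (fun x => s * k1 x + t * k2 x) x =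
  s * test_caputo_right beta a b k1 x + t * test_caputo_right beta a b k2 x.
Proof.
move=> al1 ab xab [d1 cd1 _] [d2 cd2 _]; rewrite /test_caputo_right.
have -> : derive1 (fun x => s * k1 x + t * k2 x) =
    (fun x => s * derive1 k1 x + t * derive1 k2 x).
  by apply/funext => z; exact: derive1_lincomb.
have c1 : {within `[a, b], continuous (derive1 k1)} by exact: continuous_subspaceT.
have c2 : {within `[a, b], continuous (derive1 k2)} by exact: continuous_subspaceT.
rewrite (abel_int_lincomb s t (or_intror erefl) al1 ab xab c1 c2).
exact: scale_lincomb.
Qed.

Definition variation_density alpha beta a b F y k x : R :=
  along alpha beta a b (partial2 F) y x * k x +
  along alpha beta a b (partial3 F) y x * test_caputo_left alpha a b k x +
  along alpha beta a b (partial4 F) y x * test_caputo_right beta a b k x.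

Definition first_variation alpha beta a b F y k : R :=
  \int[mu]_(x in `[a, b]) variation_density alpha beta a b F y k x.

Lemma continuous_along alpha beta a b G y : a < b -> caputo_space alpha beta a b y ->
  slab_continuous a b G -> {within `[a, b], continuous (along alpha beta a b G y)}.
Proof.
move=> ab [acy [_ _ cl] [_ _ cr]] sG; apply: slab_continuous_along => //.
exact: abs_continuous_within (ltW ab) acy.
Qed.

Lemma continuous_variation_density alpha beta a b F y k : 0 < alpha < 1 -> 0 < beta < 1 ->
  a < b -> class_C1 a b F -> caputo_space alpha beta a b y -> test_function a b k ->
  {within `[a, b], continuous (variation_density alpha beta a b F y k)}.
Proof.
move=> /andP[_ al] /andP[_ be] ab [_ [_ s2 s3 s4]] Ey tk.
apply: within_continuous_add; first apply: within_continuous_add.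
- apply: within_continuousM; first exact/continuous_along/continuous_on_slab_eps.
  exact/continuous_subspaceT/test_function_continuous/tk.
- apply: within_continuousM; first exact/continuous_along/continuous_on_slab_eps.
  exact: continuous_test_caputo_left.
- apply: within_continuousM; first exact/continuous_along/continuous_on_slab_eps.
  exact: continuous_test_caputo_right.
Qed.

Lemma first_variation_lincomb alpha beta a b F y k1 k2 s t :
  0 < alpha < 1 -> 0 < beta < 1 ->
  a < b -> class_C1 a b F -> caputo_space alpha beta a b y -> test_function a b k1 ->
  test_function a b k2 ->
  first_variation alpha beta a b F y (fun x => s * k1 x + t * k2 x) =
  s * first_variation alpha beta a b F y k1 + t * first_variation alpha beta a b F y k2.
Proof.
move=> al be ab CF Ey t1 t2; rewrite /first_variation -Rintegral_lincomb; last 2 first.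
- exact: continuous_variation_density.
- exact: continuous_variation_density.
have /andP[_ al1] := al; have /andP[_ be1] := be.
apply: eq_Rintegral => x; rewrite inE/= => xab; rewrite /variation_density.
rewrite (test_caputo_left_lincomb s t al1 ab xab t1 t2).
rewrite (test_caputo_right_lincomb s t be1 ab xab t1 t2).
exact: density_lincomb.
Qed.

(** The pointwise linearization is uniform in [x], and the Caputo derivatives of [y + k] are those
    of [y] plus continuous functions linear in [s] and [t]; so the estimate can be integrated. *)
Lemma functional_variation alpha beta a b F y k1 k2 : 0 < alpha < 1 -> 0 < beta < 1 ->
  a < b -> class_C1 a b F -> caputo_space alpha beta a b y ->
  test_function a b k1 -> test_function a b k2 ->
  forall e, 0 < e -> exists2 d, 0 < d & forall s t, `|s| < d -> `|t| < d ->
    `|functional alpha beta a b F (y \+ (fun x => s * k1 x + t * k2 x)) -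
      functional alpha beta a b F y -
      (s * first_variation alpha beta a b F y k1 +
       t * first_variation alpha beta a b F y k2)| <= e * (`|s| + `|t|).
Proof.
move=> al be ab CF Ey t1 t2 e e0.
have /andP[_ al1] := al; have /andP[_ be1] := be.
have [acy hl hr] := Ey; have [_ _ cl] := hl; have [_ _ cr] := hr.
have cy := abs_continuous_within (ltW ab) acy.
have bnd (k : R -> R) : test_function a b k -> exists2 M, 0 < M & forall x, x \in `[a, b] ->
    [/\ `|k x| <= M, `|test_caputo_left alpha a b k x| <= M &
        `|test_caputo_right beta a b k x| <= M].
  move=> tk.
  have [M1 M10 H1] := within_continuous_bounded
    (continuous_subspaceT (test_function_continuous tk) : {within `[a, b], continuous k}).
  have [M2 M20 H2] := within_continuous_bounded (continuous_test_caputo_left al1 ab tk).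
  have [M3 M30 H3] := within_continuous_bounded (continuous_test_caputo_right be1 ab tk).
  exists (M1 + M2 + M3) => [|x xab]; first by rewrite !addr_gt0.
  exact: (le_sum3 M10 M20 M30 (H1 x xab) (H2 x xab) (H3 x xab)).
have [M1 M10 H1] := bnd _ t1; have [M2 M20 H2] := bnd _ t2.
pose M := M1 + M2; have M0 : 0 < M by rewrite addr_gt0.
have comb (p q s t : R) : `|p| <= M1 -> `|q| <= M2 -> `|s * p + t * q| <= M * (`|s| + `|t|).
  move=> pM qM; apply: le_trans (ler_normD _ _) _; rewrite !normrM mulrDr.
  by rewrite lerD// mulrC ler_wpM2r// /M; [rewrite (le_trans pM)// lerDl ltW|
    rewrite (le_trans qM)// lerDr ltW].
have ba : 0 < b - a by rewrite subr_gt0.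
(* Three arguments, each moved by at most [M * (|s| + |t|)], integrated over the length [b - a],
   give exactly [e * (|s| + |t|)] with this factor. *)
have e'0 : 0 < e / (3 * M * (b - a)) by rewrite divr_gt0// !mulr_gt0.
have [d d0 Hd] := class_C1_frechet CF cy cl cr e'0.
(* Then [M * (|s| + |t|) < d], so all three perturbations stay within the range of the
   linearization. *)
exists (d / (2 * M)) => [|s t sd td]; first by rewrite divr_gt0// mulr_gt0.
pose k x := s * k1 x + t * k2 x.
have tk : test_function a b k by exact: test_functionD.
have std : M * (`|s| + `|t|) < d.
  move: sd td; rewrite !ltr_pdivlMr ?mulr_gt0//; move: M0; clear.
  by move: `|s| `|t| => p q *; lra.
have Ez : caputo_space alpha beta a b (y \+ k) by exact: caputo_spaceD.
have [_ El] := caputo_leftD al ab acy hl tk.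
have [_ Er] := caputo_rightD be ab acy hr tk.
have sF := class_C1_slab_continuous CF.
rewrite -(first_variation_lincomb s t al be ab CF Ey t1 t2) -/k /functional /first_variation.
have c1 := continuous_along ab Ez sF; have c2 := continuous_along ab Ey sF.
have c3 := continuous_variation_density al be ab CF Ey tk.
have I1 := within_continuous_integrable c1; have I2 := within_continuous_integrable c2.
have I3 := within_continuous_integrable c3.
have mD : measurable (`[a, b]%classic : set (measurableTypeR R)) by exact: measurable_itv.
have c12 : {within `[a, b], continuous (fun x => along alpha beta a b F (y \+ k) x -
    along alpha beta a b F y x)}.
  by move=> x; apply: cvgB; [exact: c1|exact: c2].
have c123 : {within `[a, b], continuous (fun x => along alpha beta a b F (y \+ k) x -
    along alpha beta a b F y x - variation_density alpha beta a b F y k x)}.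
  by move=> x; apply: cvgB; [exact: c12|exact: c3].
rewrite -(RintegralB mD I1 I2) -(RintegralB mD (within_continuous_integrable c12) I3).
apply: le_trans (le_normr_Rintegral mD (within_continuous_integrable c123)) _.
pose C := e / (3 * M * (b - a)) * (3 * (M * (`|s| + `|t|))).
apply: (@le_trans _ _ (\int[mu]_(x in `[a, b]) C)).
  apply: le_Rintegral => //.
  - apply: within_continuous_integrable => x; apply: cvg_norm; exact: c123.
  - by apply: within_continuous_integrable; exact: within_continuous_cst.
  - move=> x xab; have [p1 p2 p3] := H1 x xab; have [q1 q2 q3] := H2 x xab.
    have K1 := comb _ _ s t p1 q1; have K2 := comb _ _ s t p2 q2.
    have K3 := comb _ _ s t p3 q3.
    rewrite -(test_caputo_left_lincomb s t al1 ab xab t1 t2) in K2.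
    rewrite -(test_caputo_right_lincomb s t be1 ab xab t1 t2) in K3.
    have := Hd x (k x) _ _ xab (le_lt_trans K1 std) (le_lt_trans K2 std) (le_lt_trans K3 std).
    rewrite /along /variation_density (El x xab) (Er x xab) => /le_trans; apply.
    rewrite /C; apply: (ler_wpM2l (ltW e'0)); exact: (sum3_le K1 K2 K3).
rewrite Rintegral_cst//= lebesgue_measure_itv/= lte_fin ab -EFinB/= /C.
rewrite le_eqVlt; apply/orP; left; apply/eqP; field.
by rewrite !gt_eqF.
Qed.

End FunctionalVariation.

(** * Fubini for the singular kernel, and ordinary integration by parts *)

Section FractionalIntegrationByParts.
Context {R : realType}.
Local Notation mu := (@lebesgue_measure R).
Implicit Types (a b gam e x t : R) (f g k : R -> R).

Lemma oriented_dist_sym e x t : oriented_dist e x t = oriented_dist (- e) t x.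
Proof. by rewrite /oriented_dist; ring. Qed.

(** Both factors are extended by zero, so that Fubini can be used on the whole plane instead of the
    square. *)
Definition abel_pairing e gam a b f g (p : R * R) : R :=
  (f \_ `[a, b]) p.1 * (g \_ `[a, b]) p.2 * abel_kernel gam (oriented_dist e p.1 p.2).

Lemma measurable_patch_itv a b f : {within `[a, b], continuous f} ->
  measurable_fun setT (f \_ `[a, b]).
Proof.
move=> cf; apply/(measurable_restrictT f); first exact: measurable_itv.
by apply: subspace_continuous_measurable_fun => //; exact: measurable_itv.
Qed.

Lemma measurable_abel_pairing e gam a b f g : {within `[a, b], continuous f} ->
  {within `[a, b], continuous g} -> measurable_fun setT (abel_pairing e gam a b f g).
Proof.
move=> cf cg; apply: measurable_funM; first apply: measurable_funM.
- exact: measurableT_comp (measurable_patch_itv cf) measurable_fst.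
- exact: measurableT_comp (measurable_patch_itv cg) measurable_snd.
- apply: measurableT_comp; first exact: measurable_abel_kernel.
  apply: measurable_funM; first exact: measurable_cst.
  by apply: measurable_funB; [exact: measurable_fst|exact: measurable_snd].
Qed.

Lemma integral_abel_pairing e gam a b f g x : e = 1 \/ e = -1 -> gam < 1 -> a < b ->
  {within `[a, b], continuous g} ->
  (\int[mu]_t (abel_pairing e gam a b f g (x, t))%:E =
   (((fun x => f x * abel_int e gam a b g x)%R \_ `[a, b]) x)%:E)%E.
Proof.
move=> he g1 ab cg.
have mD : measurable (`[a, b]%classic : set (measurableTypeR R)) by exact: measurable_itv.
have [xab|xab] := boolP (x \in `[a, b]%classic); last first.
  rewrite patchN// integral0_eq// => t _.
  by rewrite /abel_pairing/= patchN// !mul0r.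
rewrite patchT//; have xab' : x \in `[a, b] by rewrite inE in xab.
have Ig : mu.-integrable `[a, b]
    (EFin \o (fun t => abel_kernel gam (oriented_dist e x t) * g t)).
  apply: integrable_abel => //.
    by apply/measurable_EFinP; exact: measurable_int (within_continuous_integrable cg).
  by have [M _ HM] := within_continuous_bounded cg; exists M.
have Ifg : mu.-integrable `[a, b]
    (EFin \o (fun t => f x * (abel_kernel gam (oriented_dist e x t) * g t))).
  exact: (integrableZl mD (f x) Ig).
rewrite /abel_int -(RintegralZl (f x) mD Ig) /Rintegral fineK; last first.
  exact: (integrable_fin_num mD Ifg).
rewrite [RHS]integral_mkcond; apply: eq_integral => t _.
rewrite /abel_pairing/= patchT// /patch; case: ifPn => // _.
  by congr EFin; rewrite mulrAC mulrA.
by rewrite mulr0 mul0r.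
Qed.

(** By Tonelli: for each [x] the inner integral is at most [Mf * Mg * K], where [K] is the integral
    of the kernel over [[- (b - a), b - a]], and the outer one runs over a bounded interval. *)
Lemma integrable_abel_pairing e gam a b f g : e = 1 \/ e = -1 -> gam < 1 -> a < b ->
  {within `[a, b], continuous f} -> {within `[a, b], continuous g} ->
  (mu \x mu)%E.-integrable setT (EFin \o abel_pairing e gam a b f g).
Proof.
move=> he g1 ab cf cg.
have mH := measurable_abel_pairing e gam cf cg.
apply/integrable12ltyP; first exact/measurable_EFinP.
have [Mf Mf0 Hf] := within_continuous_bounded cf.
have [Mg Mg0 Hg] := within_continuous_bounded cg.
have mD : measurable (`[a, b]%classic : set (measurableTypeR R)) by exact: measurable_itv.
pose N x := abel_int e gam a b (cst (Mf * Mg)) x.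
have ba : 0 < b - a by rewrite subr_gt0.
have /integrableP[_] := integrable_abel_kernel g1 ba.
under eq_integral do rewrite gee0_abs ?lee_fin ?abel_kernel_ge0//.
set K := (\int[_]_(_ in _) _)%E => Koo.
have K0 : (0 <= K)%E by apply: integral_ge0 => s _; rewrite lee_fin abel_kernel_ge0.
have Kfin : K \is a fin_num by rewrite ge0_fin_numE.
have bound x : (\int[mu]_t `|(EFin \o abel_pairing e gam a b f g) (x, t)| <=
    (((cst (Mf * Mg * fine K)%R) \_ `[a, b]) x)%:E)%E.
  have [xab|xab] := boolP (x \in `[a, b]%classic); last first.
    rewrite patchN// integral0_eq// => t _.
    by rewrite /abel_pairing/= patchN// !mul0r normr0.
  rewrite patchT//; have xab' : x \in `[a, b] by rewrite inE in xab.
  apply: (@le_trans _ _ (\int[mu]_(t in `[a, b])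
      ((Mf * Mg)%R%:E * (abel_kernel gam (oriented_dist e x t))%:E))%E).
    rewrite [leRHS]integral_mkcond; apply: ge0_le_integral => //.
    - apply: measurableT_comp => //; apply/measurable_EFinP.
      exact: (measurableT_comp mH (measurable_pair1 x)).
    - apply/(measurable_restrictT _ mD); apply/measurable_EFinP.
      apply: measurable_funM => //; apply: measurable_funTS.
      apply: measurableT_comp; first exact: measurable_abel_kernel.
      exact: measurable_oriented_dist.
    - move=> t _; rewrite /abel_pairing/= patchT// /patch; case: ifPn => [tab|_].
        rewrite -EFinM lee_fin !normrM (ger0_norm (abel_kernel_ge0 _ _)).
        rewrite ler_wpM2r ?abel_kernel_ge0// ler_pM//; first exact: Hf.
        by apply: Hg; rewrite inE in tab.
      by rewrite mulr0 mul0r normr0.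
  rewrite ge0_integralZl//; last 3 first.
  - apply/measurable_EFinP; apply: measurable_funTS.
    apply: measurableT_comp; first exact: measurable_abel_kernel.
    exact: measurable_oriented_dist.
  - by move=> t _; rewrite lee_fin abel_kernel_ge0.
  - by rewrite lee_fin mulr_ge0 ?ltW.
  rewrite [leRHS]EFinM (fineK Kfin); apply: lee_wpmul2l.
    by rewrite lee_fin mulr_ge0 ?ltW.
  exact: integral_abel_kernel_shift_le.
apply: (@le_lt_trans _ _ (\int[mu]_x (((cst (Mf * Mg * fine K)%R) \_ `[a, b]) x)%:E)%E).
  apply: ge0_le_integral => //.
  - by move=> x _; exact: integral_ge0.
  - have mabs : measurable_fun (setT : set (measurableTypeR R * measurableTypeR R))
        (fun p => `|(EFin \o abel_pairing e gam a b f g) p|%E).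
      by apply: measurableT_comp => //; exact/measurable_EFinP.
    exact: (measurable_fun_fubini_tonelli_F _ mabs (fun=> abse_ge0 _)).
  - apply/measurable_EFinP/(measurable_restrictT _ mD); exact: measurable_cst.
have -> : (\int[mu]_x (((cst (Mf * Mg * fine K)%R) \_ `[a, b]) x)%:E =
    \int[mu]_(x in `[a, b]) (cst (Mf * Mg * fine K)%:E) x)%E.
  rewrite [RHS]integral_mkcond; apply: eq_integral => x _.
  by rewrite /patch; case: ifP.
rewrite integral_cst//= lebesgue_measure_itv/= lte_fin ab -EFinB -EFinM.
exact: ltry.
Qed.

(** [oriented_dist] is antisymmetric in [x] and [t], so exchanging the order of integration reverses
    the orientation: the adjoint of the left Abel integral is the right one. *)
Lemma abel_int_Fubini e gam a b f g : e = 1 \/ e = -1 -> gam < 1 -> a < b ->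
  {within `[a, b], continuous f} -> {within `[a, b], continuous g} ->
  \int[mu]_(x in `[a, b]) (f x * abel_int e gam a b g x) =
  \int[mu]_(t in `[a, b]) (g t * abel_int (- e) gam a b f t).
Proof.
move=> he g1 ab cf cg.
have heN : - e = 1 \/ - e = -1 by case: he => ->; [right|left; rewrite opprK].
have HF := Fubini (integrable_abel_pairing he g1 ab cf cg).
rewrite [LHS]Rintegral_mkcond [RHS]Rintegral_mkcond; congr fine.
under eq_integral do rewrite -(integral_abel_pairing f _ he g1 ab cg).
under [RHS]eq_integral do rewrite -(integral_abel_pairing g _ heN g1 ab cf).
rewrite [LHS]HF; apply: eq_integral => t _; apply: eq_integral => x _.
by rewrite /abel_pairing/= oriented_dist_sym (mulrC ((f \_ _) x)).
Qed.

(** The boundary terms vanish with [k] at [a] and [b]; differentiability of [A] is one-sided at the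
    ends, where only its continuity enters. *)
Lemma test_function_by_parts a b A k : a < b ->
  (forall x, x \in `[a, b] -> derivable_on a b A x) ->
  {within `[a, b], continuous (derive_on a b A)} -> test_function a b k ->
  \int[mu]_(x in `[a, b]) (derive1 k x * A x) =
  - \int[mu]_(x in `[a, b]) (k x * derive_on a b A x).
Proof.
move=> ab dA cA tk; have [dk cdk _] := tk; have [ka kb] := test_function_ends tk.
have inab x : x \in `]a, b[ -> x \in `[a, b] by rewrite !in_itv/=; lra.
have [_ Aa Ab] := (continuous_within_itvP _ ab).1 (derivable_on_continuous dA).
have ck := test_function_continuous tk.
have dA1 x : x \in `]a, b[ -> is_derive x (1 : R) A (derive_on a b A x).
  by move=> xab; apply: derive_on_interior => //; apply: dA; exact: inab.
have := @Rintegration_by_parts R A k (derive_on a b A) (derive1 k) a b ab cA.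
rewrite ka kb !mulr0 subrr sub0r => IBP.
transitivity (\int[mu]_(x in `[a, b]) (A x * derive1 k x)).
  by apply: eq_Rintegral => x _; rewrite mulrC.
rewrite IBP.
- by congr (- _); apply: eq_Rintegral => x _; rewrite mulrC.
- by split=> // x /dA1[].
- by move=> x /dA1[? ?]; rewrite derive1E.
- exact: continuous_subspaceT.
- split.
  + by move=> x _; exact: dk.
  + by apply: cvg_at_right_filter; exact: ck.
  + by apply: cvg_at_left_filter; exact: ck.
- by [].
Qed.

End FractionalIntegrationByParts.

(** * From the first variation to the Euler-Lagrange expression *)

Section EulerLagrangeDensity.
Context {R : realType}.
Local Notation mu := (@lebesgue_measure R).
Implicit Types (a b gam alpha beta e x : R) (f y k A : R -> R).
Implicit Types (F : R -> R -> R -> R -> R).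

(** One statement for both orientations: [c] is the signed inverse of the Gamma factor, and the
    minus sign of the integration by parts becomes the sign in the opposite Riemann-Liouville
    derivative. [A] stands for [abel_right] or [abel_left], which coincide with [abel_int] on
    [[a, b]]. *)
Lemma abel_by_parts e gam a b f k A (c : R) : e = 1 \/ e = -1 -> gam < 1 -> a < b ->
  {within `[a, b], continuous f} -> test_function a b k ->
  (forall x, x \in `[a, b] -> A x = abel_int (- e) gam a b f x) ->
  (forall x, x \in `[a, b] -> derivable_on a b A x) ->
  {within `[a, b], continuous (fun x => - c * derive_on a b A x)} ->
  \int[mu]_(x in `[a, b]) (f x * (c * abel_int e gam a b (derive1 k) x)) =
  \int[mu]_(x in `[a, b]) (k x * (- c * derive_on a b A x)).
Proof.
move=> he g1 ab cf tk AE dA cA; have [_ cdk _] := tk.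
(* For [c = 0] both sides are zero; otherwise division by [- c] recovers the continuity of
   [derive_on a b A] from that of its multiple. *)
have [->|c0] := eqVneq c 0.
  apply: eq_Rintegral => x _.
  by rewrite mul0r oppr0 mul0r !mulr0.
have mD : measurable (`[a, b]%classic : set (measurableTypeR R)) by exact: measurable_itv.
have cA' : {within `[a, b], continuous (derive_on a b A)}.
  have := within_continuousM (@within_continuous_cst _ a b (- c^-1)) cA.
  have cK (z : R) : - c^-1 * (- c * z) = z by rewrite mulrA mulrNN mulVf// mul1r.
  by apply: subspace_eq_continuous => x _; exact: cK.
have cdk' : {within `[a, b], continuous (derive1 k)} := continuous_subspaceT cdk.
have ck' : {within `[a, b], continuous k} := continuous_subspaceT (test_function_continuous tk).
have cI := continuous_abel_int he g1 ab cdk (test_function_derive1_out tk).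
have I1 := within_continuous_integrable (within_continuousM cf cI).
have I2 := within_continuous_integrable (within_continuousM ck' cA').
transitivity (c * \int[mu]_(x in `[a, b]) (f x * abel_int e gam a b (derive1 k) x)).
  rewrite -(RintegralZl c mD I1); apply: eq_Rintegral => x _; exact: mulrCA.
rewrite (abel_int_Fubini he g1 ab cf cdk').
have -> : \int[mu]_(t in `[a, b]) (derive1 k t * abel_int (- e) gam a b f t) =
    \int[mu]_(t in `[a, b]) (derive1 k t * A t).
  by apply: eq_Rintegral => x; rewrite inE/= => xab; rewrite (AE x xab).
rewrite (test_function_by_parts ab dA cA' tk) mulrN -mulNr -(RintegralZl (- c) mD I2).
by apply: eq_Rintegral => x _; exact: mulrCA.
Qed.

Lemma caputo_left_by_parts alpha a b f k : 0 < alpha < 1 -> a < b ->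
  {within `[a, b], continuous f} -> test_function a b k ->
  has_continuous_RL_right alpha a b f ->
  \int[mu]_(x in `[a, b]) (f x * test_caputo_left alpha a b k x) =
  \int[mu]_(x in `[a, b]) (k x * RL_right alpha a b f x).
Proof.
move=> /andP[al0 al1] ab cf tk [_ dA cA].
have al : alpha != 0 by rewrite gt_eqF.
by apply: abel_by_parts => // [|x xab]; [left|exact: abel_rightE].
Qed.

Lemma caputo_right_by_parts beta a b f k : 0 < beta < 1 -> a < b ->
  {within `[a, b], continuous f} -> test_function a b k ->
  has_continuous_RL_left beta a b f ->
  \int[mu]_(x in `[a, b]) (f x * test_caputo_right beta a b k x) =
  \int[mu]_(x in `[a, b]) (k x * RL_left beta a b f x).
Proof.
move=> /andP[be0 be1] ab cf tk [_ dA cA].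
have be : beta != 0 by rewrite gt_eqF.
rewrite (abel_by_parts (e := -1) (gam := beta) (A := abel_left beta a f))//.
- by rewrite opprK.
- by right.
- by move=> x xab; rewrite opprK; exact: abel_leftE.
- by rewrite opprK.
Qed.

Definition euler_lagrange_density alpha beta a b F y x : R :=
  along alpha beta a b (partial2 F) y x
  + RL_right alpha a b (along alpha beta a b (partial3 F) y) x
  + RL_left beta a b (along alpha beta a b (partial4 F) y) x.

Lemma continuous_euler_lagrange_density alpha beta a b F y : a < b -> class_C1 a b F ->
  caputo_space alpha beta a b y ->
  has_continuous_RL_right alpha a b (along alpha beta a b (partial3 F) y) ->
  has_continuous_RL_left beta a b (along alpha beta a b (partial4 F) y) ->
  {within `[a, b], continuous (euler_lagrange_density alpha beta a b F y)}.
Proof.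
move=> ab [_ [_ s2 _ _]] Ey [_ _ c3] [_ _ c4].
apply: within_continuous_add; first apply: within_continuous_add.
- exact/continuous_along/continuous_on_slab_eps.
- exact: c3.
- exact: c4.
Qed.

Lemma first_variation_density alpha beta a b F y k : 0 < alpha < 1 -> 0 < beta < 1 ->
  a < b -> class_C1 a b F -> caputo_space alpha beta a b y ->
  has_continuous_RL_right alpha a b (along alpha beta a b (partial3 F) y) ->
  has_continuous_RL_left beta a b (along alpha beta a b (partial4 F) y) ->
  test_function a b k ->
  first_variation alpha beta a b F y k =
  \int[mu]_(x in `[a, b]) (k x * euler_lagrange_density alpha beta a b F y x).
Proof.
move=> al be ab CF Ey R3 R4 tk; have [_ [_ s2 s3 s4]] := CF.
have /andP[_ al1] := al; have /andP[_ be1] := be.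
have mD : measurable (`[a, b]%classic : set (measurableTypeR R)) by exact: measurable_itv.
have c2 := continuous_along ab Ey (continuous_on_slab_eps s2).
have c3 := continuous_along ab Ey (continuous_on_slab_eps s3).
have c4 := continuous_along ab Ey (continuous_on_slab_eps s4).
have ck : {within `[a, b], continuous k} := continuous_subspaceT (test_function_continuous tk).
have [_ _ cR3] := R3; have [_ _ cR4] := R4.
have cl := continuous_test_caputo_left al1 ab tk.
have cr := continuous_test_caputo_right be1 ab tk.
have i2 := within_continuous_integrable (within_continuousM c2 ck).
have i3 := within_continuous_integrable (within_continuousM c3 cl).
have i4 := within_continuous_integrable (within_continuousM c4 cr).
have i23 := within_continuous_integrable (within_continuous_add
  (within_continuousM c2 ck) (within_continuousM c3 cl)).
have j2 := within_continuous_integrable (within_continuousM ck c2).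
have j3 := within_continuous_integrable (within_continuousM ck cR3).
have j4 := within_continuous_integrable (within_continuousM ck cR4).
have j23 := within_continuous_integrable (within_continuous_add
  (within_continuousM ck c2) (within_continuousM ck cR3)).
rewrite /first_variation /variation_density.
rewrite (RintegralD mD i23 i4) (RintegralD mD i2 i3).
rewrite (caputo_left_by_parts al ab c3 tk R3) (caputo_right_by_parts be ab c4 tk R4).
have -> : \int[mu]_(x in `[a, b]) (along alpha beta a b (partial2 F) y x * k x) =
    \int[mu]_(x in `[a, b]) (k x * along alpha beta a b (partial2 F) y x).
  by apply: eq_Rintegral => x _; exact: mulrC.
rewrite -(RintegralD mD j2 j3) -(RintegralD mD j23 j4).
by apply: eq_Rintegral => x _; rewrite /euler_lagrange_density !mulrDr.
Qed.

End EulerLagrangeDensity.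

(** * Bump functions and the fundamental lemma *)

Section FundamentalLemma.
Context {R : realType}.
Local Notation mu := (@lebesgue_measure R).
Implicit Types (a b c d x w h : R) (k G : R -> R).

Definition pos_part w : R := Num.max 0 w.

Definition pos_sq w : R := pos_part w ^+ 2.

(** A quadratic error valid on both sides of the kink of [pos_part], so the derivative at 0 is
    obtained like any other. *)
Lemma pos_sq_taylor w h : `|pos_sq (h + w) - pos_sq w - 2 * pos_part w * h| <= h ^+ 2.
Proof.
rewrite /pos_sq /pos_part ler_norml.
case: (leP 0 (h + w)) => hw; case: (leP 0 w) => w0; apply/andP; split; nra.
Qed.

Lemma is_derive_pos_sq w : is_derive w (1 : R) pos_sq (2 * pos_part w).
Proof.
have cq : diff_quot pos_sq h w @[h --> 0^'] --> 2 * pos_part w.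
  apply/cvgrPdist_lt => e e0; apply/dnbhs0P; exists e => // h h0 he.
  apply: le_lt_trans he; rewrite distrC.
  have -> : diff_quot pos_sq h w - 2 * pos_part w =
      h^-1 * (pos_sq (h + w) - pos_sq w - 2 * pos_part w * h).
    by rewrite /diff_quot; field.
  rewrite normrM normfV mulrC ler_pdivrMr ?normr_gt0//.
  by rewrite -normrM -expr2 (ger0_norm (sqr_ge0 h)) pos_sq_taylor.
have dp : derivable pos_sq w 1 by rewrite derivable_diff_quot; apply/cvg_ex; eexists; exact: cq.
apply: DeriveDef => //; rewrite -derive1E; exact: cvg_lim cq.
Qed.

Lemma continuous_pos_part : continuous pos_part.
Proof.
move=> w; apply/cvgrPdist_lt => e e0; near=> z.
have : `|w - z| < e by near: z; apply: cvgr_dist_lt => //; exact: cvg_id.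
apply: le_lt_trans; rewrite /pos_part.
by case: (leP 0 w) => w0; case: (leP 0 z) => z0; rewrite ?subrr ?normr0// ler_norml
  ?lter_distl; apply/andP; split; have := ler_norm (w - z); have := ler_norm (z - w);
  rewrite (distrC z); lra.
Unshelve. all: by end_near. Qed.

(** For [c < d] the product is positive exactly on []c, d[]; squaring its positive part gives slope
    zero at [c] and [d], hence a [C^1] function. *)
Definition bump c d x : R := pos_sq ((x - c) * (d - x)).

Lemma is_derive_bump c d x :
  is_derive x (1 : R) (bump c d) (2 * pos_part ((x - c) * (d - x)) * (c + d - 2 * x)).
Proof.
have dq : is_derive x (1 : R) (fun x => (x - c) * (d - x)) (c + d - 2 * x).
  apply: is_derive_eq; rewrite /GRing.scale/=; ring.
exact: (@is_derive1_comp _ pos_sq _ x _ _ (is_derive_pos_sq ((x - c) * (d - x))) dq).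
Qed.

Lemma bump_test_function a b c d : a <= c -> c <= d -> d <= b -> test_function a b (bump c d).
Proof.
move=> ac cd db; split.
- by move=> x; have [] := is_derive_bump c d x.
- have -> : derive1 (bump c d) =
      (fun x => 2 * pos_part ((x - c) * (d - x)) * (c + d - 2 * x)).
    by apply/funext => x; rewrite derive1E; have [_ ->] := is_derive_bump c d x.
  move=> x; apply: cvgM.
    apply: cvgM; first exact: cvg_cst.
    apply: (@continuous_comp _ _ _ (fun x => (x - c) * (d - x)) pos_part);
      last exact: continuous_pos_part.
    by apply: cvgM; apply: cvgB; first [exact: cvg_id|exact: cvg_cst].
  apply: cvgB; first exact: cvg_cst.
  by apply: cvgM; [exact: cvg_cst|exact: cvg_id].
- move=> x; rewrite in_itv/= negb_and -!leNgt => xab.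
  rewrite /bump /pos_sq /pos_part (max_idPl _) ?expr0n//=.
  case/orP: xab => ?; [apply: mulr_le0_ge0|apply: mulr_ge0_le0]; lra.
Qed.

Lemma bump_ge0 c d x : 0 <= bump c d x.
Proof. by rewrite /bump /pos_sq sqr_ge0. Qed.

Lemma bump_out c d x : c <= d -> x \notin `]c, d[ -> bump c d x = 0.
Proof. by move=> cd; have [_ _] := bump_test_function (lexx c) cd (lexx d); apply. Qed.

(** On the middle half of [[c, d]] each of the factors [x - c] and [d - x] is at least
    [(d - c) / 4]. *)
Lemma bump_middle c d x : c < d -> x \in `[(3 * c + d) / 4, (c + 3 * d) / 4] ->
  ((d - c) ^+ 2 / 16) ^+ 2 <= bump c d x.
Proof.
move=> cd; rewrite in_itv/= => /andP[cx xd].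
have H : (d - c) ^+ 2 / 16 <= (x - c) * (d - x).
  have h1 : (d - c) / 4 <= x - c by lra.
  have h2 : (d - c) / 4 <= d - x by lra.
  have -> : (d - c) ^+ 2 / 16 = (d - c) / 4 * ((d - c) / 4) by field.
  by apply: ler_pM => //; apply: divr_ge0; lra.
have h0 : 0 <= (d - c) ^+ 2 / 16 by rewrite divr_ge0// sqr_ge0.
by rewrite /bump /pos_sq /pos_part (max_idPr (le_trans h0 H)) lerXn2r// nnegrE (le_trans h0).
Qed.

(** Strict positivity comes from a minorant: the constant [C] on the middle half [[u, v]] and zero
    elsewhere, with integral [C * (v - u)]. *)
Lemma bump_integral_gt0 a b c d G (m : R) : a <= c -> c < d -> d <= b -> 0 < m ->
  {within `[a, b], continuous G} -> (forall x, x \in `]c, d[ -> m <= G x) ->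
  0 < \int[mu]_(x in `[a, b]) (bump c d x * G x).
Proof.
move=> ac cd db m0 cG mG.
have tk := bump_test_function ac (ltW cd) db.
have ck : {within `[a, b], continuous (bump c d)} :=
  continuous_subspaceT (test_function_continuous tk).
pose u := (3 * c + d) / 4; pose v := (c + 3 * d) / 4.
have [cu uv vd] : [/\ c < u, u < v & v < d] by rewrite /u /v; split; lra.
pose C := ((d - c) ^+ 2 / 16) ^+ 2 * m.
have dc2 : 0 < (d - c) ^+ 2 by rewrite exprn_gt0// subr_gt0.
have C0 : 0 < C by rewrite mulr_gt0// exprn_gt0// divr_gt0.
have mI (A : interval R) : measurable ([set` A] : set (measurableTypeR R)).
  exact: measurable_itv.
have Iuv : mu.-integrable `[u, v] (EFin \o cst C).
  by apply: within_continuous_integrable; exact: within_continuous_cst.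
apply: (@lt_le_trans _ _ (\int[mu]_(x in `[a, b]) ((cst C \_ `[u, v]) x))).
  rewrite -Rintegral_mkcondr.
  have -> : `[a, b]%classic `&` `[u, v]%classic = `[u, v]%classic.
    by apply: setIidr => x /=; rewrite !in_itv/=; lra.
  rewrite Rintegral_cst//= lebesgue_measure_itv/= lte_fin uv -EFinB/=.
  by rewrite mulr_gt0// subr_gt0.
apply: le_Rintegral => //.
- have I := (integrable_mkcond _ (mI `[u, v])).1 Iuv.
  rewrite restrict_EFin in I; exact: (integrableS measurableT (mI _) (@subsetT _ _) I).
- exact: within_continuous_integrable (within_continuousM ck cG).
- move=> x xab; rewrite /patch; case: ifPn => [xuv|_].
    rewrite inE in xuv; apply: ler_pM; first by rewrite sqr_ge0.
    + exact: ltW.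
    + exact: bump_middle.
    + by apply: mG; move: xuv; rewrite /= !in_itv/=; lra.
  have [xcd|xcd] := boolP (x \in `]c, d[).
    by rewrite mulr_ge0 ?bump_ge0// (le_trans (ltW m0) (mG x xcd)).
  by rewrite bump_out ?mul0r// ltW.
Qed.

(** Where [H] is positive, a bump supported on nearby points with [H >= H x / 2] yields a positive
    integral; using this for [G] and for [- G] excludes both signs. *)
Lemma fundamental_lemma a b G : a < b -> {within `[a, b], continuous G} ->
  (forall k, test_function a b k -> \int[mu]_(x in `[a, b]) (k x * G x) = 0) ->
  forall x, x \in `[a, b] -> G x = 0.
Proof.
move=> ab.
have key (H : R -> R) : {within `[a, b], continuous H} ->
    (forall k, test_function a b k -> \int[mu]_(x in `[a, b]) (k x * H x) = 0) ->
    forall x, x \in `[a, b] -> ~ 0 < H x.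
  move=> cH H0 x xab Hx.
  have Hx2 : 0 < H x / 2 by rewrite divr_gt0.
  have [r r0 Hr] := (within_itv_epsP a b H).1 cH x xab _ Hx2.
  (* The neighbourhood of [x] is cut down to [[a, b]]. When [x] is [a] or [b] it becomes an end of
     [[c, d]], so the end points are covered too. *)
  pose c := Num.max a (x - r / 2); pose d := Num.min b (x + r / 2).
  have r20 : 0 < r / 2 by rewrite divr_gt0.
  move: (xab); rewrite in_itv/= => /andP[ax xb].
  have ac : a <= c by rewrite le_max lexx.
  have db : d <= b by rewrite ge_min lexx.
  have xc : x - r / 2 <= c by rewrite le_max lexx orbT.
  have dx : d <= x + r / 2 by rewrite ge_min lexx orbT.
  have cd : c < d by rewrite gt_max !lt_min ab/=; apply/andP; split; [|apply/andP; split]; lra.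
  have := bump_integral_gt0 ac cd db Hx2 cH.
  rewrite (H0 _ (bump_test_function ac (ltW cd) db)) ltxx => K; suff : false by [].
  apply: K => z; rewrite in_itv/= => /andP[cz zd].
  have zab : z \in `[a, b] by rewrite in_itv/=; apply/andP; split; apply: ltW;
    [exact: le_lt_trans cz|exact: lt_le_trans db].
  have zr : `|z - x| < r by rewrite ltr_norml; apply/andP; split; lra.
  by have := Hr z zab zr; rewrite ltr_norml => /andP[? ?]; lra.
move=> cG G0 x xab; apply/eqP; rewrite eq_le !leNgt.
apply/andP; split; apply/negP; first exact: key.
rewrite -oppr_gt0; apply: (key (fun x => - G x)) => //.
  by move=> z; apply: cvgN; exact: cG.
move=> k tk; have ck : {within `[a, b], continuous k} :=
  continuous_subspaceT (test_function_continuous tk).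
have I := within_continuous_integrable (within_continuousM ck cG).
have mD : measurable (`[a, b]%classic : set (measurableTypeR R)) by exact: measurable_itv.
transitivity (-1 * \int[mu]_(x in `[a, b]) (k x * G x)); last by rewrite (G0 k tk) mulr0.
rewrite -(RintegralZl (-1) mD I); apply: eq_Rintegral => z _.
by rewrite mulN1r mulrN.
Qed.

End FundamentalLemma.

(** * Linearity of the Euler-Lagrange expression in the integrand *)

Section Linearity.
Context {R : realType}.
Local Notation mu := (@lebesgue_measure R).
Implicit Types (a b gam alpha beta d s t x z : R) (f y A : R -> R).
Implicit Types (L g : R -> R -> R -> R -> R).

(** Every point of [[a, b]], ends included, is an accumulation point of it; the uniqueness of
    [derive_on] depends on that. *)
Lemma itv_other_point a b x d : a < b -> x \in `[a, b] -> 0 < d ->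
  exists z, [/\ z \in `[a, b], z != x & `|z - x| < d].
Proof.
move=> ab; rewrite in_itv/= => /andP[ax xb] d0.
have [xb'|bx] := ltP x b.
- have [m m0 [md mb]] : exists2 m : R, 0 < m & m < d /\ m <= b - x.
    exists (Num.min (d / 2) (b - x)); first by rewrite lt_min divr_gt0// subr_gt0.
    by split; [rewrite gt_min ltr_pdivrMr// ltr_pMr// ltr1n|rewrite ge_min lexx orbT].
  exists (x + m); rewrite in_itv/= addrAC subrr add0r gtr0_norm// md.
  by split=> //; [apply/andP; split; lra|rewrite gt_eqF// ltrDl].
- have [m m0 [md mb]] : exists2 m : R, 0 < m & m < d /\ m <= b - a.
    exists (Num.min (d / 2) (b - a)); first by rewrite lt_min divr_gt0// subr_gt0.
    by split; [rewrite gt_min ltr_pdivrMr// ltr_pMr// ltr1n|rewrite ge_min lexx orbT].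
  exists (x - m); rewrite in_itv/= addrAC subrr add0r normrN gtr0_norm// md.
  by split=> //; [apply/andP; split; lra|rewrite lt_eqF// gtrDl oppr_lt0].
Qed.

Lemma derive_on_unique a b f x (l : R) : a < b -> x \in `[a, b] ->
  diff_quot_on a b f x --> l -> derive_on a b f x = l.
Proof.
move=> ab xab fl.
have fl' : diff_quot_on a b f x --> derive_on a b f x.
  by apply: (cvgP l); exact: fl.
apply/eqP; rewrite -subr_eq0 -normr_le0 leNgt; apply/negP => ll.
have ll2 : 0 < `|derive_on a b f x - l| / 2 by rewrite divr_gt0.
have [d1 d10 H1] := (diff_quot_onP a b f x l).1 fl _ ll2.
have [d2 d20 H2] := (diff_quot_onP a b f x (derive_on a b f x)).1 fl' _ ll2.
have dm : 0 < Num.min d1 d2 by rewrite lt_min d10.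
have [z [zab zx]] := itv_other_point ab xab dm; rewrite lt_min => /andP[z1 z2].
have h1 := H1 z zab zx z1; have h2 := H2 z zab zx z2.
move: h1 h2; set q := _ / (z - x); move: (derive_on a b f x) => l' h1 h2.
have : `|l' - l| <= `|l' - q| + `|l - q|.
  rewrite (distrC l); have -> : l' - l = (l' - q) + (q - l) by ring.
  exact: ler_normD.
by lra.
Qed.

Lemma derive_on_lincomb a b A1 A2 A s t x : a < b -> x \in `[a, b] ->
  (forall z, z \in `[a, b] -> A z = s * A1 z + t * A2 z) ->
  derivable_on a b A1 x -> derivable_on a b A2 x ->
  derive_on a b A x = s * derive_on a b A1 x + t * derive_on a b A2 x.
Proof.
move=> ab xab AE d1 d2; apply: derive_on_unique => //; apply/diff_quot_onP => e e0.
have st0 : 0 < `|s| + `|t| + 1 by rewrite ltr_wpDl// addr_ge0.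
have e'0 : 0 < e / (`|s| + `|t| + 1) by rewrite divr_gt0.
have [r1 r10 H1] := (diff_quot_onP a b A1 x (derive_on a b A1 x)).1 d1 _ e'0.
have [r2 r20 H2] := (diff_quot_onP a b A2 x (derive_on a b A2 x)).1 d2 _ e'0.
exists (Num.min r1 r2) => [|z zab zx]; first by rewrite lt_min r10.
rewrite lt_min => /andP[z1 z2]; have := H1 z zab zx z1; have := H2 z zab zx z2.
move: (derive_on a b A1 x) (derive_on a b A2 x) => l1 l2.
rewrite (AE z zab) (AE x xab); move: (A1 z) (A1 x) (A2 z) (A2 x) => p1 p2 q1 q2 h2 h1.
have -> : s * l1 + t * l2 - (s * p1 + t * q1 - (s * p2 + t * q2)) / (z - x) =
  s * (l1 - (p1 - p2) / (z - x)) + t * (l2 - (q1 - q2) / (z - x)).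
  by rewrite !mulrBr !mulrDl; ring.
apply: le_lt_trans (ler_normD _ _) _; rewrite !normrM.
apply: (@le_lt_trans _ _ (`|s| * (e / (`|s| + `|t| + 1)) + `|t| * (e / (`|s| + `|t| + 1)))).
  by rewrite lerD// ler_wpM2l// ltW.
rewrite -mulrDl mulrA ltr_pdivrMr// mulrC ltr_pM2l// ltrDl.
exact: ltr01.
Qed.

(** Abel integrals add where they exist, which the hypotheses on [f1] and [f2] ensure at every point
    of [[a, b]]; the range [[z, b]] never leaves the interval on which [f] is known. *)
Lemma RL_right_lincomb gam a b f1 f2 f s t : a < b ->
  has_continuous_RL_right gam a b f1 -> has_continuous_RL_right gam a b f2 ->
  (forall x, x \in `[a, b] -> f x = s * f1 x + t * f2 x) ->
  forall x, x \in `[a, b] ->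
    RL_right gam a b f x = s * RL_right gam a b f1 x + t * RL_right gam a b f2 x.
Proof.
move=> ab [i1 d1 _] [i2 d2 _] fE x xab; rewrite /RL_right.
rewrite (derive_on_lincomb (s := s) (t := t) ab xab _ (d1 x xab) (d2 x xab)).
  exact: scale_lincomb.
move=> z zab; apply: Rintegral_lincomb_integrable; first exact: measurable_itv.
- exact: i1.
- exact: i2.
move=> w /= zw; rewrite fE; first by rewrite mulrDr !(mulrCA _ s) !(mulrCA _ t).
by move: zab zw; rewrite !in_itv/=; lra.
Qed.

Lemma RL_left_lincomb gam a b f1 f2 f s t : a < b ->
  has_continuous_RL_left gam a b f1 -> has_continuous_RL_left gam a b f2 ->
  (forall x, x \in `[a, b] -> f x = s * f1 x + t * f2 x) ->
  forall x, x \in `[a, b] ->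
    RL_left gam a b f x = s * RL_left gam a b f1 x + t * RL_left gam a b f2 x.
Proof.
move=> ab [i1 d1 _] [i2 d2 _] fE x xab; rewrite /RL_left.
rewrite (derive_on_lincomb (s := s) (t := t) ab xab _ (d1 x xab) (d2 x xab)).
  exact: scale_lincomb.
move=> z zab; apply: Rintegral_lincomb_integrable; first exact: measurable_itv.
- exact: i1.
- exact: i2.
move=> w /= zw; rewrite fE; first by rewrite mulrDr !(mulrCA _ s) !(mulrCA _ t).
by move: zab zw; rewrite !in_itv/=; lra.
Qed.

Lemma euler_lagrange_density_lincomb alpha beta a b L g y s t : a < b ->
  class_C1 a b L -> class_C1 a b g ->
  has_continuous_RL_right alpha a b (along alpha beta a b (partial3 L) y) ->
  has_continuous_RL_right alpha a b (along alpha beta a b (partial3 g) y) ->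
  has_continuous_RL_left beta a b (along alpha beta a b (partial4 L) y) ->
  has_continuous_RL_left beta a b (along alpha beta a b (partial4 g) y) ->
  forall x, x \in `[a, b] ->
  euler_lagrange_density alpha beta a b
    (fun x (y0 : R) u v => s * L x y0 u v + t * g x y0 u v) y x =
  s * euler_lagrange_density alpha beta a b L y x +
  t * euler_lagrange_density alpha beta a b g y x.
Proof.
move=> ab [dL _] [dg _] L3 g3 L4 g4 x xab.
rewrite /euler_lagrange_density (RL_right_lincomb (s := s) (t := t) ab L3 g3 _ xab).
  rewrite (RL_left_lincomb (s := s) (t := t) ab L4 g4 _ xab).
    have -> : along alpha beta a b
        (partial2 (fun x (y0 : R) u v => s * L x y0 u v + t * g x y0 u v)) y x =
        s * along alpha beta a b (partial2 L) y x + t * along alpha beta a b (partial2 g) y x.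
      have [_ h1 _ _] := dL x (y x) (caputo_left alpha a y x) (caputo_right beta b y x) xab.
      have [_ h2 _ _] := dg x (y x) (caputo_left alpha a y x) (caputo_right beta b y x) xab.
      exact: derive1_lincomb h1 h2.
    move: (along _ _ _ _ _ _ _) (along _ _ _ _ _ _ _) (RL_right _ _ _ _ _)
      (RL_right _ _ _ _ _) (RL_left _ _ _ _ _) (RL_left _ _ _ _ _) => *; ring.
  move=> z zab.
  have [_ _ _ h1] := dL z (y z) (caputo_left alpha a y z) (caputo_right beta b y z) zab.
  have [_ _ _ h2] := dg z (y z) (caputo_left alpha a y z) (caputo_right beta b y z) zab.
  exact: derive1_lincomb h1 h2.
move=> z zab.
have [_ _ h1 _] := dL z (y z) (caputo_left alpha a y z) (caputo_right beta b y z) zab.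
have [_ _ h2 _] := dg z (y z) (caputo_left alpha a y z) (caputo_right beta b y z) zab.
exact: derive1_lincomb h1 h2.
Qed.

End Linearity.

(** * Minimality under the constraint and the multipliers *)

Section Multiplier.
Context {R : realType}.
Implicit Types (a b alpha beta s t : R) (h k : R -> R).
Implicit Types (F L g : R -> R -> R -> R -> R).

(** Every point of the line is again in the function space, so the first-order expansion is
    available there as a new base point and gives continuity. *)
Lemma functional_line_continuous alpha beta a b F (y : R -> R) h k s :
  0 < alpha < 1 -> 0 < beta < 1 -> a < b -> class_C1 a b F ->
  caputo_space alpha beta a b y -> test_function a b h -> test_function a b k ->
  continuous (fun t => functional alpha beta a b F (y \+ (fun x => s * h x + t * k x))).
Proof.
move=> al be ab CF Ey th tk t.
have Ez := caputo_spaceD al be ab Ey (test_functionD s t th tk).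
(* The direction [k] is taken twice, the second time with coefficient 0, which reduces the
   two-parameter expansion to one parameter. *)
have [d d0 Hd] := functional_variation al be ab CF Ez tk tk ltr01.
set v := first_variation _ _ _ _ _ _ _ in Hd.
apply/cvgrPdist_lt => e e0; near=> r.
have vv : 0 < `|v| + 1 by rewrite ltr_wpDl.
have rd : `|r - t| < d by near: r; apply: cvgr_distC_lt => //; exact: cvg_id.
have re : `|r - t| < e / (`|v| + 1).
  by near: r; apply: cvgr_distC_lt; [exact: cvg_id|rewrite divr_gt0].
have := Hd (r - t) 0 rd; rewrite normr0 => /(_ d0).
have -> : (y \+ (fun x => s * h x + t * k x)) \+ (fun x => (r - t) * k x + 0 * k x) =
    y \+ (fun x => s * h x + r * k x) by apply/funext => x /=; ring.
rewrite mul0r !addr0 mul1r; move: re; rewrite ltr_pdivlMr// => re H.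
rewrite distrC; apply: le_lt_trans re.
rewrite mulrDr mulr1 [leRHS]addrC -normrM.
have perturb (p q w c : R) : `|p - q - w| <= c -> `|p - q| <= c + `|w|.
  by move=> pqw; rewrite -lerBlDr (le_trans _ pqw)// lerB_dist.
exact: (perturb _ _ _ _ H).
Unshelve. all: by end_near. Qed.

Lemma test_functionZ a b h (c : R) : test_function a b h -> test_function a b (c *: h).
Proof.
move=> th; have -> : c *: h = (fun x => c * h x + 0 * h x).
  by apply/funext => x; rewrite mul0r addr0.
exact: test_functionD.
Qed.

(* Along [y + eps h + s k] with [|s| <= eta eps], the constraint changes sign between
   [s = - eta eps] and [s = eta eps], since its derivative vanishes along [h] but not
   along [k]; the intermediate value theorem provides an admissible competitor there,
   and the functional [L] is smaller at it. *)
Lemma no_descent_direction alpha beta a b ya yb l L g (N : (R -> R) -> R) (y : R -> R) h k :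
  0 < alpha < 1 -> 0 < beta < 1 -> a < b -> class_C1 a b L -> class_C1 a b g ->
  norm_on_interval a b (caputo_space alpha beta a b) N ->
  local_minimum alpha beta a b ya yb l L g N y ->
  test_function a b h -> test_function a b k ->
  first_variation alpha beta a b g y h = 0 ->
  0 < first_variation alpha beta a b g y k ->
  first_variation alpha beta a b L y h < 0 -> False.
Proof.
move=> al be ab CL Cg [N0 _ NZ ND] [[Ey yya yyb Iyl] [del del0 Hmin]] th tk.
have VL := functional_variation al be ab CL Ey th tk.
have Vg := functional_variation al be ab Cg Ey th tk.
move: VL Vg; move: (first_variation _ _ _ _ g y h) (first_variation _ _ _ _ g y k)
  (first_variation _ _ _ _ L y h) (first_variation _ _ _ _ L y k).
move=> Ih Ik Jh Jk VL Vg Ih0 Ik0 Jh0.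
have Jk1 : 0 < `|Jk| + 1 by rewrite ltr_wpDl.
(* With [|s| <= eta * eps], the correction along [k] changes [L] to first order by at most a quarter
   of the decrease along [h]. *)
have [eta eta0 [eta1 etaJ]] : exists2 eta : R, 0 < eta & eta <= 1 /\ eta * `|Jk| <= - Jh / 4.
  exists (Num.min 1 (- Jh / 4 / (`|Jk| + 1))).
    by rewrite lt_min ltr01/= !divr_gt0// oppr_gt0.
  split; first by rewrite ge_min lexx.
  apply: (@le_trans _ _ (- Jh / 4 / (`|Jk| + 1) * `|Jk|)).
    by rewrite ler_wpM2r// ge_min lexx orbT.
  have J4 : 0 <= - Jh / 4 by rewrite divr_ge0// oppr_ge0 ltW.
  by rewrite mulrAC ler_pdivrMr// ler_wpM2l// lerDl.
(* The remainders are at most [2 * e * eps]. The first condition keeps this below an eighth of the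
   decrease; the second keeps it below half of [eta * eps * Ik], so that it cannot spoil the change
   of sign. *)
have [e e0 [eJ eI]] : exists2 e : R, 0 < e & e <= - Jh / 16 /\ e <= eta * Ik / 4.
  exists (Num.min (- Jh / 16) (eta * Ik / 4)).
    by rewrite lt_min !divr_gt0// ?oppr_gt0// mulr_gt0.
  by split; rewrite ge_min lexx ?orbT.
have [d1 d10 H1] := VL e e0; have [d2 d20 H2] := Vg e e0.
have Eh := test_function_caputo_space al be ab th.
have Ek := test_function_caputo_space al be ab tk.
have Nh := N0 _ Eh; have Nk := N0 _ Ek.
have M0 : 0 < N h + N k + 1 by rewrite ltr_wpDl// addr_ge0.
(* The last condition is for the norm: the displacement has norm at most [eps * (N h + N k)], and
   the added 1 keeps the divisor positive. *)
have [eps eps0 [eps1 eps2 epsN]] : exists2 eps : R, 0 < eps &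
    [/\ eps < d1, eps < d2 & eps * (N h + N k + 1) < del].
  pose m := Num.min (Num.min d1 d2) (del / (N h + N k + 1)).
  have m0 : 0 < m by rewrite !lt_min d10 d20 divr_gt0.
  have m2 : m / 2 < m by rewrite ltr_pdivrMr// ltr_pMr// ltr1n.
  have [md1 md2 mdel] : [/\ m <= d1, m <= d2 & m <= del / (N h + N k + 1)].
    by rewrite /m; split; rewrite !ge_min lexx ?orbT.
  exists (m / 2); first by rewrite divr_gt0.
  split; [exact: lt_le_trans m2 md1|exact: lt_le_trans m2 md2|].
  by rewrite -ltr_pdivlMr// (lt_le_trans m2 mdel).
have ee0 : 0 <= eta * eps by rewrite mulr_ge0 ?ltW.
have ee : eta * eps <= eps by rewrite ger_pMl.
have small s : `|s| <= eta * eps -> [/\ `|s| < d1, `|s| < d2 & e * (`|eps| + `|s|) <= e * (2 * eps)].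
  move=> see; have se := le_trans see ee; split; try exact: le_lt_trans se _.
  by rewrite ler_wpM2l ?(ltW e0)// (gtr0_norm eps0); lra.
pose z s : R -> R := y \+ (fun x => eps * h x + s * k x).
pose i s := functional alpha beta a b g (z s).
have ci : {within `[- (eta * eps), eta * eps], continuous i}.
  by apply: continuous_subspaceT; exact: functional_line_continuous.
have epsd1 : `|eps| < d1 by rewrite gtr0_norm.
have epsd2 : `|eps| < d2 by rewrite gtr0_norm.
have iE s : `|s| <= eta * eps -> `|i s - l - s * Ik| <= e * (2 * eps).
  move=> /small[s1 s2 s3]; have := H2 eps s epsd2 s2.
  by rewrite Iyl Ih0 mulr0 add0r => /le_trans; apply.
have eI' : e * (2 * eps) <= eta * eps * Ik / 2.
  by have := ler_wpM2r (ltW eps0) eI; clear; lra.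
have eI0 : 0 <= eta * eps * Ik by rewrite mulr_ge0// ltW.
have up (p q r : R) : `|p - l - q| <= r -> r <= q / 2 -> 0 <= q -> l <= p.
  by clear; rewrite ler_norml => /andP[plo _]; lra.
have down (p q r : R) : `|p - l - - q| <= r -> r <= q / 2 -> 0 <= q -> p <= l.
  by clear; rewrite ler_norml => /andP[_ phi]; lra.
have ip : l <= i (eta * eps).
  by apply: (up _ _ _ _ eI' eI0); apply: iE; rewrite ger0_norm.
have im : i (- (eta * eps)) <= l.
  by apply: (down _ _ _ _ eI' eI0); rewrite -(mulNr _ Ik); apply: iE; rewrite normrN ger0_norm.
have ile : - (eta * eps) <= eta * eps by rewrite ge0_cp.
have between : Num.min (i (- (eta * eps))) (i (eta * eps)) <= l <=
    Num.max (i (- (eta * eps))) (i (eta * eps)).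
  by move: im ip; move: (i (- (eta * eps))) (i (eta * eps)) => p q pl lq; rewrite ge_min le_max pl lq orbT.
have [s sin isl] := IVT (v := l) ile ci between.
have sabs : `|s| <= eta * eps by move: sin; rewrite in_itv/= ler_norml.
have [s1 s2 s3] := small s sabs.
have adm : admissible alpha beta a b ya yb l g (z s).
  have [ha hb] := test_function_ends th; have [ka kb] := test_function_ends tk.
  split; last exact: isl.
  - exact: caputo_spaceD al be ab Ey (test_functionD eps s th tk).
  - by rewrite /z/= ha ka !mulr0 !addr0.
  - by rewrite /z/= hb kb !mulr0 !addr0.
have Nz : N (y - z s) < del.
  have -> : y - z s = (- eps) *: h + (- s) *: k.
    apply/funext => x.
    by change (y x - (y x + (eps * h x + s * k x)) = - eps * h x + - s * k x); ring.
  apply: le_lt_trans epsN; apply: le_trans (ND _ _ _ _) _.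
  - exact/test_function_caputo_space/test_functionZ.
  - exact/test_function_caputo_space/test_functionZ.
  rewrite (NZ _ _ Eh) (NZ _ _ Ek) !normrN (gtr0_norm eps0).
  rewrite !mulrDr mulr1 -addrA lerD2l (le_trans (ler_wpM2r Nk (le_trans sabs ee)))//.
  by rewrite lerDl ltW.
have Jle := Hmin _ adm Nz.
have := H1 eps s epsd1 s1; rewrite -/(z s) => /le_trans /(_ s3); rewrite ler_norml => /andP[_].
move: Jle; move: (functional _ _ _ _ L _) (functional _ _ _ _ L _) => p q Jle Hq.
(* Of the decrease [- eps * Jh], a quarter at most is lost to the correction and an eighth to the
   remainder, so [L] is strictly smaller at the competitor. *)
have sJ : s * Jk <= eta * `|Jk| * eps.
  apply: le_trans (ler_norm _) _; rewrite normrM mulrAC.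
  by rewrite ler_wpM2r.
have etaJ' := ler_wpM2r (ltW eps0) etaJ.
have eJ' := ler_wpM2r (ltW eps0) eJ.
have JJ : Jh * eps < 0 by rewrite nmulr_rlt0.
move: Jle Hq sJ etaJ' eJ' JJ; clear; lra.
Qed.

(** If the determinant of the variations of [L] and [g] along [h] and [k] were nonzero, some
    combination of [h] and [k] would be stationary for the constraint and decrease [L]. *)
Lemma variation_multiplier alpha beta a b ya yb l L g (N : (R -> R) -> R) (y : R -> R) h k :
  0 < alpha < 1 -> 0 < beta < 1 -> a < b -> class_C1 a b L -> class_C1 a b g ->
  norm_on_interval a b (caputo_space alpha beta a b) N ->
  local_minimum alpha beta a b ya yb l L g N y ->
  test_function a b h -> test_function a b k ->
  first_variation alpha beta a b g y k != 0 ->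
  first_variation alpha beta a b L y h * first_variation alpha beta a b g y k =
  first_variation alpha beta a b L y k * first_variation alpha beta a b g y h.
Proof.
move=> al be ab CL Cg HN Hmin th tk Ik0; have [[Ey _ _ _] _] := Hmin.
pose D F z := first_variation alpha beta a b F y z.
have lin F s t : class_C1 a b F ->
    D F (fun x => s * h x + t * k x) = s * D F h + t * D F k.
  by move=> CF; exact: first_variation_lincomb.
(* These coefficients make the variation of [g] cancel; that of [L] becomes [c] times the
   determinant, and taking [c] as minus the determinant turns it into minus a square. *)
pose w (c : R) x := (c * D g k) * h x + (- (c * D g h)) * k x.
have tw c : test_function a b (w c) by exact: test_functionD.
have Ig c : D g (w c) = 0 by rewrite lin//; move: (D g k) (D g h) => *; ring.
have Jw c : D L (w c) = c * (D L h * D g k - D L k * D g h).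
  by rewrite lin//; move: (D g k) (D g h) (D L k) (D L h) => *; ring.
(* Scaling [k] by [D g k] makes the variation of [g] along it the positive number [(D g k) ^+ 2],
   whatever the sign of [D g k]. *)
have tk' : test_function a b (fun x => D g k * k x + 0 * k x) by exact: test_functionD.
have Ik' : 0 < D g (fun x => D g k * k x + 0 * k x).
  rewrite /D first_variation_lincomb// mul0r addr0 -expr2.
  by rewrite lt_neqAle eq_sym sqrf_eq0 Ik0 sqr_ge0.
apply/eqP; rewrite -subr_eq0; apply/negP => /negP Jne.
apply: (@no_descent_direction alpha beta a b ya yb l L g N y
  (w (- (D L h * D g k - D L k * D g h))) _ al be ab CL Cg HN Hmin (tw _) tk' (Ig _) Ik').
rewrite -/(D L (w _)) Jw mulNr -expr2 oppr_lt0.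
by rewrite lt_neqAle eq_sym sqrf_eq0 Jne sqr_ge0.
Qed.

End Multiplier.

Theorem theorem3p4 (R : realType) (a b alpha beta ya yb l : R)
    (L g : R -> R -> R -> R -> R) (N : (R -> R) -> R) (y : R -> R)
    (hab : a < b)
    (halpha : 0 < alpha < 1) (hbeta : 0 < beta < 1)
    (hL : class_C1 a b L) (hg : class_C1 a b g)
    (hN : norm_on_interval a b (caputo_space alpha beta a b) N)
    (hL3 : has_continuous_RL_right alpha a b
             (along alpha beta a b (partial3 L) y))
    (hg3 : has_continuous_RL_right alpha a b
             (along alpha beta a b (partial3 g) y))
    (hL4 : has_continuous_RL_left beta a b
             (along alpha beta a b (partial4 L) y))
    (hg4 : has_continuous_RL_left beta a b
             (along alpha beta a b (partial4 g) y))
    (hmin : local_minimum alpha beta a b ya yb l L g N y) :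
  exists lambda0 lambda : R, (lambda0, lambda) <> (0, 0) /\
    let K := fun x y0 u v => lambda0 * L x y0 u v + lambda * g x y0 u v in
    forall x, x \in `[a, b] ->
      along alpha beta a b (partial2 K) y x
      + RL_right alpha a b (along alpha beta a b (partial3 K) y) x
      + RL_left beta a b (along alpha beta a b (partial4 K) y) x = 0.
Proof.
have [[Ey _ _ _] _] := hmin.
pose D F k := first_variation alpha beta a b F y k.
pose G F := euler_lagrange_density alpha beta a b F y.
(* If some [k] has [D g k != 0], that fixed [k] gives the pair [(D g k, - D L k)] for all test
   functions. Otherwise [y] is stationary for the constraint itself and the abnormal pair [(0, 1)]
   works. *)
have [s [t [st0 stD]]] : exists s t : R, (s, t) <> (0, 0) /\
    forall k, test_function a b k -> s * D L k + t * D g k = 0.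
  have [[k [tk Ik0]]|noK] := pselect (exists k, test_function a b k /\ D g k != 0).
    exists (D g k), (- D L k); split; first by case=> /eqP; rewrite (negbTE Ik0).
    move=> h th; have E := variation_multiplier halpha hbeta hab hL hg hN hmin th tk Ik0.
    by rewrite mulrC [D L h * _]E mulNr subrr.
  exists 0, 1; split; first by case=> /eqP; rewrite oner_eq0.
  move=> k tk; rewrite mul0r add0r mul1r; apply/eqP/negPn/negP => Ik0.
  by apply: noK; exists k.
exists s, t; split => // K x xab.
rewrite -[LHS]/(euler_lagrange_density alpha beta a b K y x).
rewrite (euler_lagrange_density_lincomb s t hab hL hg hL3 hg3 hL4 hg4 xab).
have cL := continuous_euler_lagrange_density hab hL Ey hL3 hL4.
have cg := continuous_euler_lagrange_density hab hg Ey hg3 hg4.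
have cG : {within `[a, b], continuous (fun x => s * G L x + t * G g x)}.
  (* The fundamental lemma needs the combined density to be continuous; here the assumed continuity
     of the Riemann-Liouville derivatives enters, through [cL] and [cg]. *)
  exact: (within_continuous_add (within_continuousM (@within_continuous_cst R a b s) cL)
    (within_continuousM (@within_continuous_cst R a b t) cg)).
apply: (fundamental_lemma hab cG) xab => k tk.
have ck : {within `[a, b], continuous k} := continuous_subspaceT (test_function_continuous tk).
have := stD k tk; rewrite /D.
rewrite (first_variation_density halpha hbeta hab hL Ey hL3 hL4 tk).
rewrite (first_variation_density halpha hbeta hab hg Ey hg3 hg4 tk).
rewrite -(Rintegral_lincomb s t (within_continuousM ck cL) (within_continuousM ck cg)).
have distr (p q r : R) : p * (s * q + t * r) = s * (p * q) + t * (p * r).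
  by rewrite mulrDr !(mulrCA p).
by apply: etrans; apply: eq_Rintegral => z _; exact: distr.
Qed.
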